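(* Let $0<q<1$, let $N>1$ be an integer, and let $\mathcal{O}(D_q)$, $\mathcal{O}(C^N_q)$, $\Omega^n(D_q)$, $\Omega^n(C^N_q)$, $\omega$, $\omega^*$, $\mathsf{v}$ be as defined in the context. For $s\in\mathbb{Z}$ let $\mathcal{O}(D_q)_{\overline{s}}$ denote the subspace of $\mathcal{O}(D_q)$ spanned by the homogeneous elements $a$ with $\deg(a)\equiv s \bmod N$. Then $$\Omega^1(C^N_q)=\mathcal{O}(D_q)_{\overline{-2}}\,\omega\oplus\mathcal{O}(D_q)_{\overline{2}}\,\omega^*,\qquad \Omega^2(C^N_q)=\mathcal{O}(C^N_q)\,\mathsf{v}.$$ Equivalently, $\Omega(C^N_q)$ is the subspace of $\Omega(D_q)$ of all elements whose $\mathbb{Z}$-degree is a multiple of $N$ (that is, of all sums of homogeneous elements of degree divisible by $N$).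
   Context: $\mathcal{O}(D_q)$ (the quantum disc algebra) is the complex unital $*$-algebra generated by $z$ subject to $z^*z-q^2zz^*=1-q^2$. It is $\mathbb{Z}$-graded by $\deg(z)=1$, $\deg(z^* )=-1$. The automorphism $\sigma$ is given on homogeneous elements by $\sigma(a)=q^{2\deg(a)}a$. The linear maps $\partial,\bar\partial:\mathcal{O}(D_q)\to\mathcal{O}(D_q)$ are the skew-derivations determined by $$\partial(z)=z^*,\quad \partial(z^* )=0,\qquad \bar\partial(z)=0,\quad \bar\partial(z^* )=q^2z,$$ and the right $\sigma$-twisted Leibniz rule $\partial(ab)=\partial(a)\sigma(b)+a\partial(b)$, $\bar\partial(ab)=\bar\partial(a)\sigma(b)+a\bar\partial(b)$ (it is known that these are well defined). $\Omega^1(D_q)$ is the $\mathcal{O}(D_q)$-bimodule that is free as a left module on $\omega,\omega^*$ (where $\omega^*$ is also written $\bar\omega$), with right action determined by $\omega a=\sigma(a)\omega$, $\omega^*a=\sigma(a)\omega^*$, and $d(a)=\partial(a)\omega+\bar\partial(a)\omega^*$. The pair $(\Omega^1(D_q),d)$ is a first-order differential calculus (Leibniz rule holds and $\Omega^1(D_q)$ is spanned by the elements $a\,db$). $\Omega^2(D_q)$ is the module of 2-forms of its universal extension (maximal prolongation): writing $A=\mathcal{O}(D_q)$ and $\Omega^1=\Omega^1(D_q)$, it is $(\Omega^1\otimes_A\Omega^1)/R$, where $R$ is the sub-bimodule generated by all $\sum_i da_i\otimes_A db_i$ with $\sum_i a_i\,db_i=0$ in $\Omega^1$; products of one-forms are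 classes of tensor products, and $d(\sum_i a_i\,db_i)=\sum_i da_i\,db_i$. One sets $\Omega^0(D_q)=\mathcal{O}(D_q)$, $\Omega^n(D_q)=0$ for $n>2$, and $$\mathsf{v}=\frac{q^{-6}}{q^2-1}\left(\omega^*\omega+q^8\omega\omega^*\right)\in\Omega^2(D_q).$$ The $\mathbb{Z}$-grading extends to $\Omega(D_q)=\bigoplus_n\Omega^n(D_q)$ with $\deg(\omega)=2$, $\deg(\omega^* )=-2$, $\deg(\mathsf{v})=0$, so that $d$ has degree zero. The quantum cone algebra $\mathcal{O}(C^N_q)$ is the subalgebra of $\mathcal{O}(D_q)$ consisting of all sums of homogeneous elements of $\mathbb{Z}$-degree divisible by $N$. The calculus $\Omega(C^N_q)=\bigoplus_n\Omega^n(C^N_q)$ is the restriction of $\Omega(D_q)$ to $\mathcal{O}(C^N_q)$: $$\Omega^n(C^N_q)=\Big\{\sum_i a_0^i\,d(a_1^i)\cdots d(a_n^i)\,a_{n+1}^i \;\Big|\; a_k^i\in\mathcal{O}(C^N_q)\Big\}\subseteq\Omega^n(D_q)$$ (finite sums). *)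

(* Defs.v *)
From HB Require Import structures.
From mathcomp Require Import all_boot all_order all_algebra generic_quotient ring_quotient.
From mathcomp Require Import boolp classical_sets reals complex.

Set Implicit Arguments.
Unset Strict Implicit.
Unset Printing Implicit Defensive.

Import Order.TTheory GRing.Theory Num.Theory.

Local Open Scope ring_scope.
Local Open Scope quotient_scope.
Local Open Scope complex_scope.
Local Open Scope classical_set_scope.

Section QuantumDisc.
Context {R : realType} (q : R).

(* O(D_q): formal algebraic expressions in z and z^*, modulo the smallest
   congruence [disc_eqv] that contains the axioms of unital R[i]-algebras and
   the relation  z^* z - q^2 z z^* = 1 - q^2.  Since q is real the relation is
   self-adjoint, so the algebra presented in this way is also the *-algebra
   generated by z subject to the relation; see [star] below. *)
Inductive disc_term : Type :=
| TZ | TZs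
| TScal of R[i]
| TOpp of disc_term
| TAdd of disc_term & disc_term
| TMul of disc_term & disc_term.

Inductive disc_eqv : disc_term -> disc_term -> Prop :=
| eqv_refl t : disc_eqv t t
| eqv_sym s t : disc_eqv s t -> disc_eqv t s
| eqv_trans s t u : disc_eqv s t -> disc_eqv t u -> disc_eqv s u
| eqv_opp s t : disc_eqv s t -> disc_eqv (TOpp s) (TOpp t)
| eqv_add s s' t t' : disc_eqv s s' -> disc_eqv t t' ->
    disc_eqv (TAdd s t) (TAdd s' t')
| eqv_mul s s' t t' : disc_eqv s s' -> disc_eqv t t' ->
    disc_eqv (TMul s t) (TMul s' t')
| eqv_addA s t u : disc_eqv (TAdd s (TAdd t u)) (TAdd (TAdd s t) u)
| eqv_addC s t : disc_eqv (TAdd s t) (TAdd t s)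
| eqv_add0 t : disc_eqv (TAdd (TScal 0) t) t
| eqv_addN t : disc_eqv (TAdd (TOpp t) t) (TScal 0)
| eqv_mulA s t u : disc_eqv (TMul s (TMul t u)) (TMul (TMul s t) u)
| eqv_mul1 t : disc_eqv (TMul (TScal 1) t) t
| eqv_mulDl s t u : disc_eqv (TMul (TAdd s t) u) (TAdd (TMul s u) (TMul t u))
| eqv_mulDr s t u : disc_eqv (TMul s (TAdd t u)) (TAdd (TMul s t) (TMul s u))
| eqv_scalD c d : disc_eqv (TScal (c + d)) (TAdd (TScal c) (TScal d))
| eqv_scalM c d : disc_eqv (TScal (c * d)) (TMul (TScal c) (TScal d))
| eqv_scalC c t : disc_eqv (TMul (TScal c) t) (TMul t (TScal c))
| eqv_disc :
    disc_eqv (TAdd (TMul TZs TZ) (TOpp (TMul (TScal (q ^+ 2)%:C) (TMul TZ TZs))))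
             (TScal (1 - q ^+ 2)%:C).

HB.instance Definition _ := gen_eqMixin disc_term.
HB.instance Definition _ := gen_choiceMixin disc_term.

Definition disc_eqvb : rel disc_term := fun s t => `[< disc_eqv s t >].

Lemma disc_eqvb_class : equiv_class_of disc_eqvb.
Proof.
split=> [t|s t|t s u].
- by apply/asboolP; apply: eqv_refl.
- by apply/asboolP/asboolP; apply: eqv_sym.
- by move=> /asboolP st /asboolP tu; apply/asboolP; apply: eqv_trans st tu.
Qed.

Canonical disc_equiv := EquivRelPack disc_eqvb_class.

Definition disc := {eq_quot disc_equiv}.

HB.instance Definition _ := Choice.on disc.

Definition cls (t : disc_term) : disc := \pi_({eq_quot disc_equiv}) t.
Definition rep (a : disc) : disc_term := repr (a : {eq_quot disc_equiv}).

Lemma clsP s t : (cls s = cls t) <-> disc_eqv s t.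
Proof.
split; first by move/eqmodP/asboolP.
by move=> h; apply/eqmodP/asboolP.
Qed.

Lemma cls_rep t : disc_eqv (rep (cls t)) t.
Proof. by apply/clsP; rewrite /cls /rep reprK. Qed.

Lemma cls_ind (P : disc -> Prop) : (forall t, P (cls t)) -> forall a, P a.
Proof. by move=> Pt a; rewrite -[a](@reprK _ {eq_quot disc_equiv}); apply: Pt. Qed.

Definition disc_zero : disc := cls (TScal 0).
Definition disc_one : disc := cls (TScal 1).
Definition disc_opp (a : disc) : disc := cls (TOpp (rep a)).
Definition disc_add (a b : disc) : disc := cls (TAdd (rep a) (rep b)).
Definition disc_mul (a b : disc) : disc := cls (TMul (rep a) (rep b)).
Definition disc_scale (c : R[i]) (a : disc) : disc := cls (TMul (TScal c) (rep a)).

Lemma cls_opp t : disc_opp (cls t) = cls (TOpp t).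
Proof. by apply/clsP/eqv_opp/cls_rep. Qed.
Lemma cls_add s t : disc_add (cls s) (cls t) = cls (TAdd s t).
Proof. by apply/clsP/eqv_add; apply: cls_rep. Qed.
Lemma cls_mul s t : disc_mul (cls s) (cls t) = cls (TMul s t).
Proof. by apply/clsP/eqv_mul; apply: cls_rep. Qed.
Lemma cls_scale c t : disc_scale c (cls t) = cls (TMul (TScal c) t).
Proof. by apply/clsP/eqv_mul; [apply: eqv_refl|apply: cls_rep]. Qed.

Let cls_ops := (cls_opp, cls_add, cls_mul, cls_scale).

Lemma disc_addA : associative disc_add.
Proof.
by elim/cls_ind=> s; elim/cls_ind=> t; elim/cls_ind=> u; rewrite !cls_ops;
  apply/clsP/eqv_addA.
Qed.
Lemma disc_addC : commutative disc_add.
Proof.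
by elim/cls_ind=> s; elim/cls_ind=> t; rewrite !cls_ops; apply/clsP/eqv_addC.
Qed.
Lemma disc_add0 : left_id disc_zero disc_add.
Proof. by elim/cls_ind=> t; rewrite !cls_ops; apply/clsP/eqv_add0. Qed.
Lemma disc_addN : left_inverse disc_zero disc_opp disc_add.
Proof. by elim/cls_ind=> t; rewrite !cls_ops; apply/clsP/eqv_addN. Qed.

HB.instance Definition _ :=
  GRing.isZmodule.Build disc disc_addA disc_addC disc_add0 disc_addN.

Lemma disc_mulA : associative disc_mul.
Proof.
by elim/cls_ind=> s; elim/cls_ind=> t; elim/cls_ind=> u; rewrite !cls_ops;
  apply/clsP/eqv_mulA.
Qed.
Lemma disc_mul1r : left_id disc_one disc_mul.
Proof. by elim/cls_ind=> t; rewrite !cls_ops; apply/clsP/eqv_mul1. Qed.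
Lemma disc_mulr1 : right_id disc_one disc_mul.
Proof.
elim/cls_ind=> t; rewrite !cls_ops; apply/clsP.
by apply: eqv_trans (eqv_mul1 t); apply/eqv_sym/eqv_scalC.
Qed.
Lemma disc_mulDl : left_distributive disc_mul +%R.
Proof.
elim/cls_ind=> s; elim/cls_ind=> t; elim/cls_ind=> u; rewrite /GRing.add /= !cls_ops.
by apply/clsP/eqv_mulDl.
Qed.
Lemma disc_mulDr : right_distributive disc_mul +%R.
Proof.
elim/cls_ind=> s; elim/cls_ind=> t; elim/cls_ind=> u; rewrite /GRing.add /= !cls_ops.
by apply/clsP/eqv_mulDr.
Qed.

(* Evaluation at z = z^* = 1 is a character, so that O(D_q) is not zero. *)
Fixpoint disc_char (t : disc_term) : R[i] :=
  match t with
  | TZ | TZs => 1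
  | TScal c => c
  | TOpp s => - disc_char s
  | TAdd s t => disc_char s + disc_char t
  | TMul s t => disc_char s * disc_char t
  end.

Lemma disc_char_eqv s t : disc_eqv s t -> disc_char s = disc_char t.
Proof.
elim=> //=; try congruence.
- by move=> *; rewrite addrA.
- by move=> *; rewrite addrC.
- by move=> *; rewrite add0r.
- by move=> *; rewrite addNr.
- by move=> *; rewrite mulrA.
- by move=> *; rewrite mul1r.
- by move=> *; rewrite mulrDl.
- by move=> *; rewrite mulrDr.
- by move=> *; rewrite mulrC.
- by rewrite !mulr1 rmorphB.
Qed.

Lemma disc_oner_neq0 : disc_one != 0.
Proof.
by apply/eqP => /clsP/disc_char_eqv /= /eqP; rewrite oner_eq0.
Qed.

HB.instance Definition _ := GRing.Zmodule_isNzRing.Build disc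
  disc_mulA disc_mul1r disc_mulr1 disc_mulDl disc_mulDr disc_oner_neq0.

Lemma disc_scaleA c d a : disc_scale c (disc_scale d a) = disc_scale (c * d) a.
Proof.
elim/cls_ind: a => t; rewrite !cls_ops; apply/clsP.
apply: eqv_trans (eqv_mulA _ _ _) _; apply: eqv_mul; last exact: eqv_refl.
by apply: eqv_sym; apply: eqv_scalM.
Qed.
Lemma disc_scale1 : left_id 1 disc_scale.
Proof. by elim/cls_ind=> t; rewrite !cls_ops; apply/clsP/eqv_mul1. Qed.
Lemma disc_scaleDr : right_distributive disc_scale +%R.
Proof.
move=> c; elim/cls_ind=> s; elim/cls_ind=> t; rewrite /GRing.add /= !cls_ops.
by apply/clsP/eqv_mulDr.
Qed.
Lemma disc_scaleDl a : {morph disc_scale^~ a : c d / c + d}.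
Proof.
move=> c d; elim/cls_ind: a => t; rewrite /GRing.add /= !cls_ops; apply/clsP.
apply: eqv_trans (eqv_mulDl _ _ _).
by apply: eqv_mul; [apply: eqv_scalD|apply: eqv_refl].
Qed.

HB.instance Definition _ := GRing.Zmodule_isLmodule.Build R[i] disc
  disc_scaleA disc_scale1 disc_scaleDr disc_scaleDl.

Lemma disc_scaleAl (c : R[i]) (a b : disc) : c *: (a * b) = (c *: a) * b.
Proof.
elim/cls_ind: a => s; elim/cls_ind: b => t.
rewrite /GRing.mul /GRing.scale /= !cls_ops; apply/clsP/eqv_mulA.
Qed.
HB.instance Definition _ := GRing.Lmodule_isLalgebra.Build R[i] disc disc_scaleAl.

Lemma disc_scaleAr (c : R[i]) (a b : disc) : c *: (a * b) = a * (c *: b).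
Proof.
elim/cls_ind: a => s; elim/cls_ind: b => t.
rewrite /GRing.mul /GRing.scale /= !cls_ops; apply/clsP.
apply: eqv_trans (eqv_mulA _ _ _) _.
apply: eqv_trans (eqv_sym (eqv_mulA _ _ _)).
by apply: eqv_mul; [apply: eqv_scalC|apply: eqv_refl].
Qed.
HB.instance Definition _ := GRing.Lalgebra_isAlgebra.Build R[i] disc disc_scaleAr.

Definition dz : disc := cls TZ.
Definition dzs : disc := cls TZs.

Lemma clsN t : cls (TOpp t) = - (cls t : disc).
Proof. by rewrite -cls_opp. Qed.
Lemma clsD s t : cls (TAdd s t) = (cls s : disc) + cls t.
Proof. by rewrite -cls_add. Qed.
Lemma clsM s t : cls (TMul s t) = (cls s : disc) * cls t.
Proof. by rewrite -cls_mul. Qed.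
Lemma clsC c : cls (TScal c) = c%:A :> disc.
Proof.
rewrite /GRing.scale /= cls_scale; apply/clsP.
apply: eqv_trans (eqv_scalM _ _); rewrite mulr1; exact: eqv_refl.
Qed.

Lemma disc_rel : dzs * dz - (q ^+ 2)%:C *: (dz * dzs) = (1 - q ^+ 2)%:C%:A.
Proof.
have /clsP := eqv_disc.
by rewrite clsC clsD clsN !clsM clsC -scalerAl mul1r.
Qed.

Lemma disc_ind (P : disc -> Prop) :
  P dz -> P dzs -> (forall c : R[i], P c%:A) ->
  (forall a b, P a -> P b -> P (a + b)) ->
  (forall a b, P a -> P b -> P (a * b)) -> forall a, P a.
Proof.
move=> Pz Pzs Pc PD PM; elim/cls_ind; elim=> //.
- by move=> c; rewrite clsC.
- move=> t Pt; rewrite clsN -[- _]mulN1r; apply: PM => //.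
  by rewrite -(scale1r 1) -scaleNr; apply: Pc.
- by move=> s Ps t Pt; rewrite clsD; apply: PD.
- by move=> s Ps t Pt; rewrite clsM; apply: PM.
Qed.

Fixpoint star_term (t : disc_term) : disc_term :=
  match t with
  | TZ => TZs
  | TZs => TZ
  | TScal c => TScal (conjc c)
  | TOpp s => TOpp (star_term s)
  | TAdd s t => TAdd (star_term s) (star_term t)
  | TMul s t => TMul (star_term t) (star_term s)
  end.

Definition star (a : disc) : disc := cls (star_term (rep a)).

(* The algebra endomorphism multiplying z by q^2 and z^* by q^-2; for q != 0 it
   is well defined and sigma(a) = q^(2 deg a) a ([sigma_homog]). *)
Fixpoint sigma_term (t : disc_term) : disc :=
  match t with
  | TZ => (q ^+ 2)%:C *: dz
  | TZs => (q ^- 2)%:C *: dzs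
  | TScal c => c%:A
  | TOpp s => - sigma_term s
  | TAdd s t => sigma_term s + sigma_term t
  | TMul s t => sigma_term s * sigma_term t
  end.

Definition sigma (a : disc) : disc := sigma_term (rep a).

(* The linear map D with value dz0 on z, value dzs0 on z^* and the twisted
   Leibniz rule  D(ab) = D(a) sigma(b) + a D(b). *)
Fixpoint skew_term (dz0 dzs0 : disc) (t : disc_term) : disc :=
  match t with
  | TZ => dz0
  | TZs => dzs0
  | TScal _ => 0
  | TOpp s => - skew_term dz0 dzs0 s
  | TAdd s t => skew_term dz0 dzs0 s + skew_term dz0 dzs0 t
  | TMul s t =>
      skew_term dz0 dzs0 s * sigma (cls t) + cls s * skew_term dz0 dzs0 t
  end.

Definition del (a : disc) : disc := skew_term dzs 0 (rep a).
Definition delbar (a : disc) : disc := skew_term 0 ((q ^+ 2)%:C *: dz) (rep a).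

(* [homog n a]: a is homogeneous of degree n, for the Z-grading of O(D_q) with
   deg z = 1 and deg z^* = -1. *)
Inductive homog : int -> disc -> Prop :=
| homog_z : homog 1 dz
| homog_zs : homog (-1) dzs
| homog_C (c : R[i]) : homog 0 c%:A
| homog_0 n : homog n 0
| homog_D n a b : homog n a -> homog n b -> homog n (a + b)
| homog_M m n a b : homog m a -> homog n b -> homog (m + n) (a * b).

Lemma star_term_eqv s t :
  disc_eqv s t -> disc_eqv (star_term s) (star_term t).
Proof.
have conjR (x : R) : conjc x%:C = x%:C by rewrite /= oppr0.
elim=> {s t} /=.
- by move=> t; apply: eqv_refl.
- by move=> s t _; apply: eqv_sym.
- by move=> s t u _ h1 _ h2; apply: eqv_trans h1 h2.
- by move=> s t _; apply: eqv_opp.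
- by move=> s s' t t' _ h1 _ h2; apply: eqv_add.
- by move=> s s' t t' _ h1 _ h2; apply: eqv_mul.
- by move=> *; apply: eqv_addA.
- by move=> *; apply: eqv_addC.
- by move=> t; rewrite oppr0; apply: eqv_add0.
- by move=> t; rewrite oppr0; apply: eqv_addN.
- by move=> s t u; apply/eqv_sym/eqv_mulA.
- move=> t; rewrite oppr0; apply: eqv_trans (eqv_mul1 _).
  by apply/eqv_sym/eqv_scalC.
- by move=> *; apply: eqv_mulDr.
- by move=> *; apply: eqv_mulDl.
- by move=> c d; rewrite -[_ (c + d)]/(conjc (c + d)) rmorphD; apply: eqv_scalD.
- by move=> c d; rewrite -[_ (c * d)]/(conjc (c * d)) mulrC rmorphM; apply: eqv_scalM.
- by move=> c t; apply/eqv_sym/eqv_scalC.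
- rewrite oppr0; apply: eqv_trans eqv_disc.
  apply: eqv_add; [exact: eqv_refl|apply: eqv_opp].
  by apply/eqv_sym/eqv_scalC.
Qed.

Lemma starP t : star (cls t) = cls (star_term t).
Proof. exact/clsP/star_term_eqv/cls_rep. Qed.

Lemma star_z : star dz = dzs.
Proof. by rewrite starP. Qed.
Lemma starD a b : star (a + b) = star a + star b.
Proof.
elim/cls_ind: a => s; elim/cls_ind: b => t.
by rewrite -clsD !starP /= clsD.
Qed.
Lemma starM a b : star (a * b) = star b * star a.
Proof.
elim/cls_ind: a => s; elim/cls_ind: b => t.
by rewrite -clsM !starP /= clsM.
Qed.
Lemma starZ (c : R[i]) a : star (c *: a) = conjc c *: star a.
Proof.
rewrite -[c *: a]mul1r -scalerAr scalerAl starM -[_%:A]clsC starP /= clsC.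
by rewrite -scalerAr mulr1.
Qed.
Lemma starK : involutive star.
Proof.
apply: disc_ind => [|||a b ha hb|a b ha hb].
- by rewrite /dz !starP.
- by rewrite /dzs !starP.
- by case=> x y; rewrite -clsC !starP /= opprK.
- by rewrite !starD ha hb.
- by rewrite !starM ha hb.
Qed.

Section SkewDerivations.
Hypothesis q_neq0 : q != 0.

Lemma sigma_term_eqv s t : disc_eqv s t -> sigma_term s = sigma_term t.
Proof.
elim=> {s t} //=; try congruence.
- by move=> *; rewrite addrA.
- by move=> *; rewrite addrC.
- by move=> u; rewrite scale0r add0r.
- by move=> u; rewrite scale0r addNr.
- by move=> *; rewrite mulrA.
- by move=> *; rewrite scale1r mul1r.
- by move=> *; rewrite mulrDl.
- by move=> *; rewrite mulrDr.
- by move=> *; rewrite scalerDl.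
- by move=> *; rewrite -scalerAl mul1r scalerA.
- by move=> *; rewrite -scalerAl -scalerAr mul1r mulr1.
- rewrite -!scalerAl -!scalerAr !scalerA mul1r.
  rewrite -!rmorphM /= mulVf ?mulfV ?expf_neq0 // mulr1 scale1r.
  by rewrite -disc_rel.
Qed.

Lemma sigmaP t : sigma (cls t) = sigma_term t.
Proof. exact/sigma_term_eqv/cls_rep. Qed.

Lemma sigma_z : sigma dz = (q ^+ 2)%:C *: dz.
Proof. by rewrite sigmaP. Qed.
Lemma sigma_zs : sigma dzs = (q ^- 2)%:C *: dzs.
Proof. by rewrite sigmaP. Qed.
Lemma sigmaC (c : R[i]) : sigma c%:A = c%:A.
Proof. by rewrite -[in LHS]clsC sigmaP. Qed.
Lemma sigmaD a b : sigma (a + b) = sigma a + sigma b.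
Proof. by elim/cls_ind: a => s; elim/cls_ind: b => t; rewrite -clsD !sigmaP. Qed.
Lemma sigmaM a b : sigma (a * b) = sigma a * sigma b.
Proof. by elim/cls_ind: a => s; elim/cls_ind: b => t; rewrite -clsM !sigmaP. Qed.

Lemma sigma_homog n a : homog n a -> sigma a = (q ^ (2 * n))%:C *: a.
Proof.
elim=> {n a}.
- by rewrite sigma_z.
- by rewrite sigma_zs.
- by move=> c; rewrite sigmaC mulr0 expr0z scale1r.
- by move=> n; rewrite scaler0 -[in LHS](scale0r 1) sigmaC scale0r.
- by move=> n a b _ ha _ hb; rewrite sigmaD ha hb scalerDr.
- move=> m n a b _ ha _ hb; rewrite sigmaM ha hb mulrDr expfzDr //.
  by rewrite -scalerAl -scalerAr scalerA rmorphM.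
Qed.

Lemma skew_term_eqv dz0 dzs0 s t :
  dzs0 * sigma dz + dzs * dz0
    = (q ^+ 2)%:C *: (dz0 * sigma dzs + dz * dzs0) ->
  disc_eqv s t -> skew_term dz0 dzs0 s = skew_term dz0 dzs0 t.
Proof.
move=> h0; elim=> {s t} //=; try congruence.
- move=> s s' u u' es Es eu Eu.
  by rewrite Es Eu (proj2 (clsP _ _) es) (proj2 (clsP _ _) eu).
- by move=> *; rewrite addrA.
- by move=> *; rewrite addrC.
- by move=> *; rewrite add0r.
- by move=> *; rewrite addNr.
- by move=> *; rewrite !clsM sigmaM mulrDr mulrDl !mulrA addrA.
- by move=> *; rewrite mul0r add0r clsC scale1r mul1r.
- by move=> *; rewrite clsD !mulrDl !addrA; congr (_ + _); rewrite -!addrA [X in _ + X]addrC.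
- by move=> *; rewrite clsD sigmaD !mulrDr !addrA; congr (_ + _); rewrite -!addrA [X in _ + X]addrC.
- by rewrite addr0.
- by move=> *; rewrite mul0r mulr0 addr0.
- move=> c u; rewrite mul0r mulr0 add0r addr0 clsC sigmaC.
  by rewrite -scalerAl -scalerAr mul1r mulr1.
- rewrite mul0r add0r clsC -scalerAl mul1r.
  by rewrite -/dz -/dzs h0 subrr.
Qed.

Lemma skewP dz0 dzs0 t :
  dzs0 * sigma dz + dzs * dz0
    = (q ^+ 2)%:C *: (dz0 * sigma dzs + dz * dzs0) ->
  skew_term dz0 dzs0 (rep (cls t)) = skew_term dz0 dzs0 t.
Proof. by move=> h0; apply: skew_term_eqv => //; apply: cls_rep. Qed.

Lemma skew_delP :
  0 * sigma dz + dzs * dzs = (q ^+ 2)%:C *: (dzs * sigma dzs + dz * 0).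
Proof.
rewrite mul0r add0r mulr0 addr0 sigma_zs -scalerAr scalerA -rmorphM /=.
by rewrite mulfV ?expf_neq0 // scale1r.
Qed.
Lemma skew_delbarP :
  ((q ^+ 2)%:C *: dz) * sigma dz + dzs * 0
    = (q ^+ 2)%:C *: (0 * sigma dzs + dz * ((q ^+ 2)%:C *: dz)).
Proof. by rewrite mul0r add0r mulr0 addr0 sigma_z -!scalerAl -!scalerAr. Qed.

Lemma del_z : del dz = dzs.
Proof. by rewrite /del skewP //; apply: skew_delP. Qed.
Lemma del_zs : del dzs = 0.
Proof. by rewrite /del skewP //; apply: skew_delP. Qed.
Lemma delC (c : R[i]) : del c%:A = 0.
Proof. by rewrite -clsC /del skewP //; apply: skew_delP. Qed.
Lemma delD a b : del (a + b) = del a + del b.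
Proof.
elim/cls_ind: a => s; elim/cls_ind: b => t; rewrite -clsD /del.
by rewrite !skewP //; apply: skew_delP.
Qed.
Lemma delM a b : del (a * b) = del a * sigma b + a * del b.
Proof.
elim/cls_ind: a => s; elim/cls_ind: b => t; rewrite -clsM /del.
by rewrite !skewP //; apply: skew_delP.
Qed.

Lemma delbar_z : delbar dz = 0.
Proof. by rewrite /delbar skewP //; apply: skew_delbarP. Qed.
Lemma delbar_zs : delbar dzs = (q ^+ 2)%:C *: dz.
Proof. by rewrite /delbar skewP //; apply: skew_delbarP. Qed.
Lemma delbarC (c : R[i]) : delbar c%:A = 0.
Proof. by rewrite -clsC /delbar skewP //; apply: skew_delbarP. Qed.
Lemma delbarD a b : delbar (a + b) = delbar a + delbar b.
Proof.
elim/cls_ind: a => s; elim/cls_ind: b => t; rewrite -clsD /delbar.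
by rewrite !skewP //; apply: skew_delbarP.
Qed.
Lemma delbarM a b : delbar (a * b) = delbar a * sigma b + a * delbar b.
Proof.
elim/cls_ind: a => s; elim/cls_ind: b => t; rewrite -clsM /delbar.
by rewrite !skewP //; apply: skew_delbarP.
Qed.

End SkewDerivations.

(* Omega^1(D_q): the pair (a, b) is the one-form  a omega + b omega^*. *)
Definition Omega1 : Type := (disc^o * disc^o)%type.
HB.instance Definition _ := GRing.Lmodule.on Omega1.

Definition omega : Omega1 := (1, 0).
Definition omegas : Omega1 := (0, 1).

(* The right action, determined by  omega a = sigma(a) omega  and
   omega^* a = sigma(a) omega^*. *)
Definition ract1 (x : Omega1) (a : disc) : Omega1 :=
  (x.1 * sigma a) *: omega + (x.2 * sigma a) *: omegas.

Definition diff (a : disc) : Omega1 := del a *: omega + delbar a *: omegas.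

Lemma Omega1E (x : Omega1) : x = (x.1 : disc) *: omega + (x.2 : disc) *: omegas.
Proof.
by case: x => a b; congr pair => /=;
  rewrite /GRing.scale /= mulr0 mulr1 ?addr0 ?add0r.
Qed.

Lemma ract1E x a : ract1 x a = (x.1 * sigma a, x.2 * sigma a).
Proof. by rewrite [RHS]Omega1E. Qed.

Lemma diffE a : diff a = (del a, delbar a).
Proof. by rewrite [RHS]Omega1E. Qed.

Lemma diffM a b : q != 0 -> diff (a * b) = ract1 (diff a) b + a *: diff b.
Proof. by move=> q0; rewrite ract1E !diffE delM // delbarM. Qed.

(* Omega^1 (x)_A Omega^1 for A = O(D_q): formal sums of pure tensors modulo the
   smallest congruence containing the axioms of abelian groups, biadditivity
   and the A-balancing relation. *)
Inductive tens_term : Type :=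
| TTens of Omega1 & Omega1
| TTZero
| TTOpp of tens_term
| TTAdd of tens_term & tens_term.

Inductive tens_eqv : tens_term -> tens_term -> Prop :=
| teqv_refl t : tens_eqv t t
| teqv_sym s t : tens_eqv s t -> tens_eqv t s
| teqv_trans s t u : tens_eqv s t -> tens_eqv t u -> tens_eqv s u
| teqv_opp s t : tens_eqv s t -> tens_eqv (TTOpp s) (TTOpp t)
| teqv_add s s' t t' : tens_eqv s s' -> tens_eqv t t' ->
    tens_eqv (TTAdd s t) (TTAdd s' t')
| teqv_addA s t u : tens_eqv (TTAdd s (TTAdd t u)) (TTAdd (TTAdd s t) u)
| teqv_addC s t : tens_eqv (TTAdd s t) (TTAdd t s)
| teqv_add0 t : tens_eqv (TTAdd TTZero t) t
| teqv_addN t : tens_eqv (TTAdd (TTOpp t) t) TTZero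
| teqv_tensDl x x' y :
    tens_eqv (TTens (x + x') y) (TTAdd (TTens x y) (TTens x' y))
| teqv_tensDr x y y' :
    tens_eqv (TTens x (y + y')) (TTAdd (TTens x y) (TTens x y'))
| teqv_balanced x a y : tens_eqv (TTens (ract1 x a) y) (TTens x (a *: y)).

HB.instance Definition _ := gen_eqMixin tens_term.
HB.instance Definition _ := gen_choiceMixin tens_term.

Definition tens_eqvb : rel tens_term := fun s t => `[< tens_eqv s t >].

Lemma tens_eqvb_class : equiv_class_of tens_eqvb.
Proof.
split=> [t|s t|t s u].
- by apply/asboolP; apply: teqv_refl.
- by apply/asboolP/asboolP; apply: teqv_sym.
- by move=> /asboolP st /asboolP tu; apply/asboolP; apply: teqv_trans st tu.
Qed.

Canonical tens_equiv := EquivRelPack tens_eqvb_class.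

Definition Omega11 := {eq_quot tens_equiv}.
HB.instance Definition _ := Choice.on Omega11.

Definition tcls (t : tens_term) : Omega11 := \pi_({eq_quot tens_equiv}) t.
Definition trep (x : Omega11) : tens_term := repr (x : {eq_quot tens_equiv}).

Lemma tclsP s t : tcls s = tcls t <-> tens_eqv s t.
Proof.
split; first by move/eqmodP/asboolP.
by move=> h; apply/eqmodP/asboolP.
Qed.

Lemma tcls_rep t : tens_eqv (trep (tcls t)) t.
Proof. by apply/tclsP; rewrite /tcls /trep reprK. Qed.

Lemma tcls_ind (P : Omega11 -> Prop) : (forall t, P (tcls t)) -> forall x, P x.
Proof. by move=> Pt x; rewrite -[x](@reprK _ {eq_quot tens_equiv}); apply: Pt. Qed.

Definition tens (x y : Omega1) : Omega11 := tcls (TTens x y).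

Definition tens_opp (x : Omega11) : Omega11 := tcls (TTOpp (trep x)).
Definition tens_add (x y : Omega11) : Omega11 := tcls (TTAdd (trep x) (trep y)).

Lemma tcls_opp t : tens_opp (tcls t) = tcls (TTOpp t).
Proof. by apply/tclsP/teqv_opp/tcls_rep. Qed.
Lemma tcls_add s t : tens_add (tcls s) (tcls t) = tcls (TTAdd s t).
Proof. by apply/tclsP/teqv_add; apply: tcls_rep. Qed.

Let tcls_ops := (tcls_opp, tcls_add).

Lemma tens_addA : associative tens_add.
Proof.
by elim/tcls_ind=> s; elim/tcls_ind=> t; elim/tcls_ind=> u; rewrite !tcls_ops;
  apply/tclsP/teqv_addA.
Qed.
Lemma tens_addC : commutative tens_add.
Proof.
by elim/tcls_ind=> s; elim/tcls_ind=> t; rewrite !tcls_ops; apply/tclsP/teqv_addC.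
Qed.
Lemma tens_add0 : left_id (tcls TTZero) tens_add.
Proof. by elim/tcls_ind=> t; rewrite !tcls_ops; apply/tclsP/teqv_add0. Qed.
Lemma tens_addN : left_inverse (tcls TTZero) tens_opp tens_add.
Proof. by elim/tcls_ind=> t; rewrite !tcls_ops; apply/tclsP/teqv_addN. Qed.

HB.instance Definition _ :=
  GRing.isZmodule.Build Omega11 tens_addA tens_addC tens_add0 tens_addN.

Lemma tcls0 : tcls TTZero = 0. Proof. by []. Qed.
Lemma tclsN t : tcls (TTOpp t) = - tcls t.
Proof. by rewrite -tcls_opp. Qed.
Lemma tclsD s t : tcls (TTAdd s t) = tcls s + tcls t.
Proof. by rewrite -tcls_add. Qed.

Lemma tensDl x x' y : tens (x + x') y = tens x y + tens x' y.
Proof. by rewrite -tclsD; apply/tclsP/teqv_tensDl. Qed.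
Lemma tensDr x y y' : tens x (y + y') = tens x y + tens x y'.
Proof. by rewrite -tclsD; apply/tclsP/teqv_tensDr. Qed.
Lemma tens_balanced x a y : tens (ract1 x a) y = tens x (a *: y).
Proof. exact/tclsP/teqv_balanced. Qed.

Lemma Omega11_ind (P : Omega11 -> Prop) :
  (forall x y, P (tens x y)) -> P 0 -> (forall u, P u -> P (- u)) ->
  (forall u v, P u -> P v -> P (u + v)) -> forall u, P u.
Proof.
move=> Pt P0 PN PD; elim/tcls_ind; elim=> //.
- by move=> t Pt'; rewrite tclsN; apply: PN.
- by move=> s Ps t Pt'; rewrite tclsD; apply: PD.
Qed.

Lemma ract1D x x' a : ract1 (x + x') a = ract1 x a + ract1 x' a.
Proof. by rewrite !ract1E; congr pair; rewrite /= mulrDl. Qed.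
Lemma ract1Z a x b : ract1 (a *: x) b = a *: ract1 x b.
Proof. by rewrite !ract1E; congr pair; rewrite /GRing.scale /= mulrA. Qed.

Fixpoint lact_term (a : disc) (t : tens_term) : tens_term :=
  match t with
  | TTens x y => TTens (a *: x) y
  | TTZero => TTZero
  | TTOpp s => TTOpp (lact_term a s)
  | TTAdd s t => TTAdd (lact_term a s) (lact_term a t)
  end.

Fixpoint ract_term (t : tens_term) (a : disc) : tens_term :=
  match t with
  | TTens x y => TTens x (ract1 y a)
  | TTZero => TTZero
  | TTOpp s => TTOpp (ract_term s a)
  | TTAdd s t => TTAdd (ract_term s a) (ract_term t a)
  end.

Definition lact11 (a : disc) (x : Omega11) : Omega11 := tcls (lact_term a (trep x)).
Definition ract11 (x : Omega11) (a : disc) : Omega11 := tcls (ract_term (trep x) a).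

Lemma lact_term_eqv a s t : tens_eqv s t -> tcls (lact_term a s) = tcls (lact_term a t).
Proof.
elim=> {s t} /=; try congruence.
- by move=> s t _ h; rewrite !tclsN h.
- by move=> s s' t t' _ h _ h'; rewrite !tclsD h h'.
- by move=> *; rewrite !tclsD addrA.
- by move=> *; rewrite !tclsD addrC.
- by move=> *; rewrite !tclsD add0r.
- by move=> *; rewrite !tclsD tclsN addNr.
- by move=> *; rewrite tclsD -tensDl -scalerDr.
- by move=> *; rewrite tclsD -tensDr.
- by move=> *; rewrite -ract1Z; apply/tclsP/teqv_balanced.
Qed.

Lemma ract_term_eqv a s t : tens_eqv s t -> tcls (ract_term s a) = tcls (ract_term t a).
Proof.
elim=> {s t} /=; try congruence.
- by move=> s t _ h; rewrite !tclsN h.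
- by move=> s s' t t' _ h _ h'; rewrite !tclsD h h'.
- by move=> *; rewrite !tclsD addrA.
- by move=> *; rewrite !tclsD addrC.
- by move=> *; rewrite !tclsD add0r.
- by move=> *; rewrite !tclsD tclsN addNr.
- by move=> *; rewrite tclsD -tensDl.
- by move=> *; rewrite tclsD -tensDr -ract1D.
- by move=> *; rewrite ract1Z; apply/tclsP/teqv_balanced.
Qed.

Lemma lact11_tcls a t : lact11 a (tcls t) = tcls (lact_term a t).
Proof. exact/lact_term_eqv/tcls_rep. Qed.
Lemma ract11_tcls t a : ract11 (tcls t) a = tcls (ract_term t a).
Proof. exact/ract_term_eqv/tcls_rep. Qed.

Lemma lact11_tens a x y : lact11 a (tens x y) = tens (a *: x) y.
Proof. exact: lact11_tcls. Qed.
Lemma lact11_0 a : lact11 a 0 = 0.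
Proof. exact: lact11_tcls. Qed.
Lemma lact11N a u : lact11 a (- u) = - lact11 a u.
Proof. by elim/tcls_ind: u => t; rewrite -tclsN !lact11_tcls /= tclsN. Qed.
Lemma lact11D a : {morph lact11 a : u v / u + v}.
Proof.
by elim/tcls_ind=> s; elim/tcls_ind=> t; rewrite -tclsD !lact11_tcls /= tclsD.
Qed.
Lemma lact11A a b u : lact11 a (lact11 b u) = lact11 (a * b) u.
Proof.
elim/Omega11_ind: u => [x y||u hu|u v hu hv].
- by rewrite !lact11_tens scalerA.
- by rewrite !lact11_0.
- by rewrite !lact11N hu.
- by rewrite !lact11D hu hv.
Qed.
Lemma lact11_1 : left_id 1 lact11.
Proof.
elim/Omega11_ind => [x y||u hu|u v hu hv].
- by rewrite lact11_tens scale1r.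
- by rewrite lact11_0.
- by rewrite lact11N hu.
- by rewrite lact11D hu hv.
Qed.
Lemma lact11Dl u : {morph lact11^~ u : a b / a + b}.
Proof.
move=> a b; elim/Omega11_ind: u => [x y||u hu|u v hu hv].
- by rewrite !lact11_tens scalerDl tensDl.
- by rewrite !lact11_0 addr0.
- by rewrite !lact11N hu opprD.
- by rewrite !lact11D hu hv addrACA.
Qed.

HB.instance Definition _ := GRing.Zmodule_isLmodule.Build disc Omega11
  lact11A lact11_1 lact11D lact11Dl.

Lemma scale_tens (a : disc) x y : a *: tens x y = tens (a *: x) y.
Proof. exact: lact11_tens. Qed.
Lemma ract11_tens x y a : ract11 (tens x y) a = tens x (ract1 y a).
Proof. exact: ract11_tcls. Qed.
Lemma ract11_0 a : ract11 0 a = 0.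
Proof. exact: ract11_tcls. Qed.
Lemma ract11N a u : ract11 (- u) a = - ract11 u a.
Proof. by elim/tcls_ind: u => t; rewrite -tclsN !ract11_tcls /= tclsN. Qed.
Lemma ract11D a u v : ract11 (u + v) a = ract11 u a + ract11 v a.
Proof.
by elim/tcls_ind: u => s; elim/tcls_ind: v => t;
  rewrite -tclsD !ract11_tcls /= tclsD.
Qed.

(* The sub-bimodule R generated by all  sum_i d(a_i) (x) d(b_i)  with
   sum_i a_i d(b_i) = 0. *)
Inductive prolong : Omega11 -> Prop :=
| prolong_gen (s : seq (disc * disc)) :
    \sum_(p <- s) p.1 *: diff p.2 = 0 ->
    prolong (\sum_(p <- s) tens (diff p.1) (diff p.2))
| prolong_0 : prolong 0
| prolong_D u v : prolong u -> prolong v -> prolong (u + v)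
| prolong_lact a u : prolong u -> prolong (a *: u)
| prolong_ract a u : prolong u -> prolong (ract11 u a).

Definition prolongb : {pred Omega11} := fun u => `[< prolong u >].

Lemma prolongb_zmod : zmod_closed prolongb.
Proof.
split=> [|u v /asboolP hu /asboolP hv]; apply/asboolP; first exact: prolong_0.
by apply: prolong_D => //; rewrite -scaleN1r; apply: prolong_lact.
Qed.

HB.instance Definition _ := GRing.isZmodClosed.Build Omega11 prolongb prolongb_zmod.

Definition Omega2 : Type := Quotient.quot prolongb.
HB.instance Definition _ := GRing.Zmodule.on Omega2.

Definition cls2 (u : Omega11) : Omega2 := \pi_(Quotient.quot prolongb) u.
Definition rep2 (x : Omega2) : Omega11 := repr (x : Quotient.quot prolongb).

Lemma cls2P u v : cls2 u = cls2 v <-> prolong (u - v).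
Proof.
have h := Quotient.idealrBE prolongb u v; split.
  by move=> e; apply/asboolP; move: h; rewrite [X in _ = X](introT eqP e).
by move=> /asboolP p; apply/eqP; rewrite -h.
Qed.

Lemma rep2K x : cls2 (rep2 x) = x.
Proof. by rewrite /cls2 /rep2 reprK. Qed.

Lemma cls2D u v : cls2 (u + v) = cls2 u + cls2 v.
Proof. by rewrite /cls2 raddfD. Qed.

Definition lact2 (a : disc) (x : Omega2) : Omega2 := cls2 (a *: rep2 x).
Definition ract2 (x : Omega2) (a : disc) : Omega2 := cls2 (ract11 (rep2 x) a).

Lemma lact2_cls a u : lact2 a (cls2 u) = cls2 (a *: u).
Proof.
apply/cls2P; rewrite -scalerBr; apply: prolong_lact.
by apply/cls2P; rewrite rep2K.
Qed.
Lemma ract2_cls u a : ract2 (cls2 u) a = cls2 (ract11 u a).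
Proof.
apply/cls2P; rewrite -ract11N -ract11D; apply: prolong_ract.
by apply/cls2P; rewrite rep2K.
Qed.

Lemma lact2A a b x : lact2 a (lact2 b x) = lact2 (a * b) x.
Proof. by rewrite -(rep2K x) !lact2_cls scalerA. Qed.
Lemma lact2_1 : left_id 1 lact2.
Proof. by move=> x; rewrite -(rep2K x) !lact2_cls scale1r. Qed.
Lemma lact2D a : {morph lact2 a : x y / x + y}.
Proof.
by move=> x y; rewrite -(rep2K x) -(rep2K y) -cls2D !lact2_cls scalerDr cls2D.
Qed.
Lemma lact2Dl x : {morph lact2^~ x : a b / a + b}.
Proof. by move=> a b; rewrite -(rep2K x) !lact2_cls scalerDl cls2D. Qed.

HB.instance Definition _ := GRing.Zmodule_isLmodule.Build disc Omega2
  lact2A lact2_1 lact2D lact2Dl.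

Lemma scale_cls2 (a : disc) u : a *: cls2 u = cls2 (a *: u).
Proof. exact: lact2_cls. Qed.

Definition wedge (x y : Omega1) : Omega2 := cls2 (tens x y).

Definition vol : Omega2 :=
  ((q ^- 6 / (q ^+ 2 - 1))%:C%:A : disc) *:
    (wedge omegas omega + ((q ^+ 8)%:C%:A : disc) *: wedge omega omegas).

(* Omega(D_q) = A (+) Omega^1 (+) Omega^2; the forms of degree > 2 vanish. *)
Definition Omega : Type := (disc * Omega1 * Omega2)%type.
HB.instance Definition _ := GRing.Zmodule.on Omega.

(* The finite sums of elements of P; it is the linear span of P when P is
   closed under scalars. *)
Definition sums (V : zmodType) (P : set V) : set V :=
  [set x | exists2 s : seq V, (forall y, y \in s -> P y) & x = \sum_(y <- s) y].

(* The Z-grading of Omega(D_q): the multiplicative extension of that of A with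
   deg omega = 2 and deg omega^* = -2. *)
Definition homog1 (n : int) : set Omega1 :=
  [set x | exists a b, [/\ homog (n - 2) a, homog (n + 2) b
                         & x = a *: omega + b *: omegas]].

Definition homog2 (n : int) : set Omega2 :=
  sums [set w | exists i j x y, [/\ i + j = n, homog1 i x, homog1 j y
                                  & w = wedge x y]].

Definition homogOmega (n : int) : set Omega :=
  [set w | [/\ homog n w.1.1, homog1 n w.1.2 & homog2 n w.2]].

Variable N : nat.

Definition disc_mod (s : int) : set disc :=
  sums [set a | exists2 n : int, (n = s %[mod N])%Z & homog n a].

Definition cone : set disc :=
  sums [set a | exists2 n : int, (N %| n)%Z & homog n a].

Definition cone0 : set disc :=
  sums [set w | exists a0 a1, [/\ cone a0, cone a1 & w = a0 * a1]].

Definition cone1 : set Omega1 :=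
  sums [set w | exists a0 a1 a2, [/\ cone a0, cone a1, cone a2
                                   & w = ract1 (a0 *: diff a1) a2]].

Definition cone2 : set Omega2 :=
  sums [set w | exists a0 a1 a2 a3, [/\ cone a0, cone a1, cone a2 & cone a3] /\
                  w = ract2 (a0 *: wedge (diff a1) (diff a2)) a3].

Definition coneOmega : set Omega :=
  [set w | [/\ cone0 w.1.1, cone1 w.1.2 & cone2 w.2]].

End QuantumDisc.

Arguments disc_mod {R} q N s _.
Arguments cone {R} q N _.
Arguments cone0 {R} q N _.
Arguments cone1 {R} q N _.
Arguments cone2 {R} q N _.
Arguments coneOmega {R} q N _.
Arguments homogOmega {R} q n _.

(* Main.v *)
Require Import Defs.
From mathcomp Require Import all_boot all_order all_algebra.
From mathcomp Require Import boolp classical_sets reals complex.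
From mathcomp Require Import ring zify.

Import Order.TTheory GRing.Theory Num.Theory.

Local Open Scope ring_scope.
Local Open Scope classical_set_scope.

(** Write X = 1 - z z^*, an element of degree 0 that commutes with z and z^* up to
    powers of q and commutes with omega and omega^*.  The calculus has a symmetry
    exchanging z with z^*, omega with omega^* and q with 1/q; a tuple
    (p, Z, W, eta, theta) satisfying [orientation] is either of the two readings, and
    each computation below is made once, for such a tuple.

    One-forms.  Everything in Omega^1(C) has degree divisible by N because d has
    degree 0.  Conversely, the polynomials f such that a f(X) eta lies in Omega^1(C)
    for every a of degree congruent to - 2 deg Z modulo N form an ideal.  It contains
      - the product of W^(N-2) Z^(N-2), written as a polynomial in X, with the linear
        polynomial alpha - beta X given by d(Z^N) = c Z^(N-2) (alpha - beta X) eta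
        ([diff_exp]);
      - X (X - 1) (X - p^2), because W^2 X eta is a combination of X dX and dX X
        ([cone1_W2_defect]) and Z^2 W^2 vanishes at X = 1 and X = p^2.
    These two polynomials are coprime, as p is not a root of unity
    ([root_poly_coprime]), so a eta itself lies in Omega^1(C) ([cone1_eta]).

    Two-forms.  Applying d to the identities dZ = c W eta, eta Z = p^2 Z eta and
    eta W = p^-2 W eta gives relations in Omega^2(D).  They force X to annihilate all
    products of eta and theta, so that W^k Z^k and Z^k W^k act on them as the identity,
    and then every product of two generators is an element of O(D) times
    omega omega^*, which is the volume form ([eta_theta_structure], [vol_omega]).
    Hence forms of degree n are elements of degree n times the volume form
    ([wedge_homog]); and a v lies in Omega^2(C) for a in O(C), since it equals the
    product of q^-4 a z^*^2 omega and z^2 omega^*, both in Omega^1(C)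
    ([cone2_vol]). *)

(** * The disc relation *)

Section DiscRelation.
Context {F : fieldType} {A : algType F} {p : F} {Z W : A}.

(** Locked, since rewriting with distributivity would otherwise see through it. *)
Definition defect : A := locked (1 - Z * W).

Lemma defectE : defect = 1 - Z * W. Proof. by rewrite /defect -lock. Qed.

Definition disc_relation : Prop := W * Z = p ^+ 2 *: (Z * W) + (1 - p ^+ 2)%:A.

Lemma mul_ZW : Z * W = 1 - defect.
Proof. by rewrite defectE opprB addrC subrK. Qed.

Hypothesis rel : disc_relation.

Lemma mul_WZ : W * Z = 1 - p ^+ 2 *: defect.
Proof.
by rewrite rel defectE scalerBr scalerBl scale1r opprB addrA addrAC addrC addrA addrAC.
Qed.

Lemma defectZ : defect * Z = p ^+ 2 *: (Z * defect).
Proof.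
by rewrite [X in X * _]defectE mulrBl mul1r -mulrA mul_WZ mulrBr mulr1 opprB addrC subrK -scalerAr.
Qed.

Lemma W_defect : W * defect = p ^+ 2 *: (defect * W).
Proof.
by rewrite [X in _ * X]defectE mulrBr mulr1 mulrA mul_WZ mulrBl mul1r opprB addrC subrK -scalerAl.
Qed.

Lemma defectZn n : defect * Z ^+ n = p ^+ (2 * n) *: (Z ^+ n * defect).
Proof.
elim: n => [|n IH]; first by rewrite muln0 !expr0 mulr1 mul1r scale1r.
rewrite [in LHS]exprSr mulrA IH -scalerAl -(mulrA _ defect) defectZ -scalerAr scalerA.
by rewrite (mulrA _ Z) -exprSr -exprD addnC -mulnS.
Qed.

Hypothesis p0 : p != 0.

(** Exchanging the generators inverts the parameter. *)
Lemma disc_relation_swap : Z * W = p^-1 ^+ 2 *: (W * Z) + (1 - p^-1 ^+ 2)%:A.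
Proof.
rewrite rel exprVn scalerDr !scalerA -addrA -scalerDl mulrBr mulr1.
by rewrite mulVf ?expf_neq0 // addrC subrKA subrr scale0r scale1r add0r.
Qed.

Lemma defectW : defect * W = p ^- 2 *: (W * defect).
Proof. by rewrite W_defect scalerA mulVf ?expf_neq0 // scale1r. Qed.

Lemma defectWn n : defect * W ^+ n = p ^- (2 * n) *: (W ^+ n * defect).
Proof.
elim: n => [|n IH]; first by rewrite muln0 !expr0 mulr1 mul1r invr1 scale1r.
rewrite [in LHS]exprSr mulrA IH -scalerAl -(mulrA _ defect) defectW -scalerAr scalerA.
by rewrite (mulrA _ W) -exprSr -invfM -exprD addnC -mulnS.
Qed.

(** A polynomial in the defect; an element of O(C) of degree 0. *)
Definition at_defect (f : {poly F}) : A := horner_alg defect f.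

Lemma at_defectM f g : at_defect (f * g) = at_defect f * at_defect g. Proof. exact: rmorphM. Qed.
Lemma at_defectD f g : at_defect (f + g) = at_defect f + at_defect g. Proof. exact: rmorphD. Qed.
Lemma at_defect1 : at_defect 1 = 1. Proof. exact: rmorph1. Qed.
Lemma at_defectC c : at_defect c%:P = c%:A. Proof. exact: horner_algC. Qed.
Lemma at_defectX : at_defect 'X = defect. Proof. exact: horner_algX. Qed.
Lemma at_defectZ c f : at_defect (c *: f) = c *: at_defect f.
Proof. by rewrite -mul_polyC at_defectM at_defectC mulr_algl. Qed.
Lemma at_defectB f g : at_defect (f - g) = at_defect f - at_defect g. Proof. exact: rmorphB. Qed.

Lemma WnZn n : W ^+ n * Z ^+ n
  = at_defect (\prod_(i < n) (1 - p ^+ (2 * i.+1) *: 'X)).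
Proof.
elim: n => [|n IH]; first by rewrite big_ord0 at_defect1 mulr1.
rewrite big_ord_recr /= at_defectM at_defectB at_defect1 at_defectZ at_defectX -IH.
rewrite exprSr exprS -!mulrA.
congr (_ * _); rewrite (mulrA W) mul_WZ mulrBl mulrBr mul1r mulr1 -scalerAl defectZn.
by rewrite -scalerAr scalerA -exprD mulnS.
Qed.

Lemma Z2W2 : Z ^+ 2 * W ^+ 2
  = (1 - defect) * (1 - p ^- 2 *: defect).
Proof.
rewrite -mul_ZW !expr2 -!mulrA; congr (_ * _); rewrite mulrA mul_ZW.
by rewrite mulrBl mulrBr mul1r mulr1 defectW -scalerAr.
Qed.

(** The linear polynomial f with d(Z^n) = c Z^(n-2) f(X) eta, for n >= 2; its root is
    (1 + p^2) / (1 + p^(2n)). *)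
Definition exp_poly n : {poly F} :=
  (\sum_(i < n) (p ^+ 2) ^+ i)%:P - (\sum_(i < n) (p ^+ 4) ^+ i) *: 'X.

Lemma sum_exprS (x : F) n : \sum_(i < n.+1) x ^+ i = x * (\sum_(i < n) x ^+ i) + 1.
Proof.
rewrite big_ord_recl expr0 addrC mulr_sumr; congr (_ + _).
by apply: eq_bigr => i _; rewrite exprS.
Qed.

(** The twisted Leibniz rule passing from d(Z^(k+2)) to d(Z^(k+3)) when n = k + 2. *)
Lemma exp_poly_step n k : Z ^+ k * at_defect (exp_poly n) * (p ^+ 2 *: Z) + Z ^+ k.+2 * W
   = Z ^+ k.+1 * at_defect (exp_poly n.+1).
Proof.
rewrite /exp_poly !sum_exprS; set a := \sum_(i < n) _; set b := \sum_(i < n) _.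
have hl c d : at_defect (c%:P - d *: 'X) = c%:A - d *: defect.
  by rewrite at_defectB at_defectZ at_defectC at_defectX.
rewrite !hl (exprSr Z k.+1) (exprSr Z k) -!(mulrA (Z ^+ k)) -(mulrA Z) mul_ZW -mulrDr.
congr (_ * _); rewrite -scalerAr mulrBl !mulrBr -!scalerAl -!scalerAr !mul1r !mulr1.
rewrite defectZ !scalerDl !scale1r scalerBr !scalerA addrACA -opprD.
congr (_ - (_ *: _ + _)); ring.
Qed.

(** The polynomial f with W^n d(Z^(n+2)) = c f(X) eta. *)
Definition root_poly n : {poly F} :=
  (\prod_(i < n) (1 - p ^+ (2 * i.+1) *: 'X)) * exp_poly n.+2.

Hypothesis p_unity : forall k, (0 < k)%N -> p ^+ k != 1.

Lemma geometric_sum (x : F) n : (1 - x) * (\sum_(i < n) x ^+ i) = 1 - x ^+ n.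
Proof. by rewrite -opprB -[1 - x ^+ n]opprB mulNr -subrX1. Qed.

(** None of 0, 1 and p^2 is a root: the product contributes the roots p^-2, ..., p^(-2n)
    and [exp_poly] the root (1 + p^2) / (1 + p^(2n+4)). *)
Lemma root_poly_coprime n : coprimep (root_poly n) ('X * ('X - 1) * ('X - (p ^+ 2)%:P)).
Proof.
have h2 : 1 - p ^+ 2 != 0 by rewrite subr_eq0 eq_sym p_unity.
have h4 : 1 - p ^+ 4 != 0 by rewrite subr_eq0 eq_sym p_unity.
set a := \sum_(i < n.+2) (p ^+ 2) ^+ i.
set b := \sum_(i < n.+2) (p ^+ 4) ^+ i.
have Ea : (1 - p ^+ 2) * a = 1 - p ^+ (2 * n.+2) by rewrite exprM geometric_sum.
have Eb : (1 - p ^+ 4) * b = 1 - p ^+ (2 * n.+2) * p ^+ (2 * n.+2).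
  by rewrite -exprD -mulnDl exprM geometric_sum.
have G0 c : (forall i, p ^+ (2 * i.+1) * c != 1) -> a - b * c != 0 -> ~~ root (root_poly n) c.
  move=> h1 h3; rewrite /root_poly rootM negb_or /root; apply/andP; split.
    rewrite horner_prod; apply/prodf_neq0 => i _.
    by rewrite !hornerE subr_eq0 eq_sym.
  by rewrite /exp_poly -/a -/b !hornerE.
rewrite !coprimepMr -[X in coprimep _ X]subr0 -['X - 1]/('X - 1%:P) -polyC0 !coprimep_XsubC.
apply/andP; split; first (apply/andP; split); apply: G0.
- by move=> i; rewrite mulr0 eq_sym oner_neq0.
- rewrite mulr0 subr0; apply/eqP => a0.
  move: Ea; rewrite a0 mulr0 => /esym/eqP; rewrite subr_eq0 eq_sym; exact/negP/p_unity.
- by move=> i; rewrite mulr1 p_unity.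
- rewrite mulr1; apply/eqP => /(congr1 (fun x => (1 - p ^+ 4) * x)).
  have -> : (1 - p ^+ 4) * (a - b) = (1 + p ^+ 2) * ((1 - p ^+ 2) * a) - (1 - p ^+ 4) * b by ring.
  rewrite Ea Eb mulr0 => E.
  have : p ^+ 2 * (1 - p ^+ (2 * n.+2)) * (1 - p ^+ (2 * n.+1)) = 0.
    by rewrite -[RHS]E mulnS exprD; ring.
  move/eqP; rewrite !mulf_eq0 !subr_eq0 (negbTE p0).
  by rewrite ![1 == _]eq_sym !(negbTE (p_unity _ _)).
- by move=> i; rewrite -exprD p_unity.
- apply/eqP => /(congr1 (fun x => (1 - p ^+ 4) * x)).
  have -> : (1 - p ^+ 4) * (a - b * p ^+ 2)
      = (1 + p ^+ 2) * ((1 - p ^+ 2) * a) - (1 - p ^+ 4) * b * p ^+ 2 by ring.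
  rewrite Ea Eb mulr0 => E.
  have : (1 - p ^+ (2 * n.+2)) * (1 - p ^+ (2 * n.+3)) = 0.
    by rewrite -[RHS]E (mulnS 2 n.+2) exprD; ring.
  move/eqP; rewrite !mulf_eq0 !subr_eq0.
  by rewrite ![1 == _]eq_sym !(negbTE (p_unity _ _)).
Qed.
End DiscRelation.

Arguments defect {F A} Z W.
Arguments disc_relation {F A} p Z W.
Arguments at_defect {F A} Z W f.
Arguments exp_poly {F} p n.
Arguments root_poly {F} p n.

(** * Spans and the grading *)

Section Sums.
Context {V : zmodType}.
Implicit Types (P Q : set V) (K : V -> Prop).

Lemma sums_in P x : P x -> sums P x.
Proof.
move=> Px; exists [:: x]; last by rewrite big_seq1.
by move=> y; rewrite inE => /eqP->.
Qed.

Lemma sums0 P : sums P 0.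
Proof. by exists [::]; rewrite ?big_nil. Qed.

Lemma sumsD P x y : sums P x -> sums P y -> sums P (x + y).
Proof.
move=> [s sP ->] [t tP ->]; exists (s ++ t); last by rewrite big_cat.
by move=> z; rewrite mem_cat => /orP[/sP|/tP].
Qed.

Lemma sums_ind P K : K 0 -> (forall x y, P x -> K y -> K (x + y)) ->
  forall x, sums P x -> K x.
Proof.
move=> K0 KD x [s sP ->]; elim: s sP => [|y s IH] sP; first by rewrite big_nil.
rewrite big_cons; apply: KD; first by apply: sP; rewrite inE eqxx.
by apply: IH => z zs; apply: sP; rewrite inE zs orbT.
Qed.

End Sums.

(** An inclusion between spans may be checked on generators, through any additive map.
    Multilinear expressions are handled by applying this in each argument. *)
Lemma sums_map {V U : zmodType} (P : set V) (Q : set U) (f : V -> U) :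
  {morph f : x y / x + y} -> (forall x, P x -> sums Q (f x)) ->
  forall x, sums P x -> sums Q (f x).
Proof.
move=> fD fP; apply: sums_ind => [|x y Px]; last first.
  by move=> Qy; rewrite fD; apply: sumsD => //; apply: fP.
suff -> : f 0 = 0 by apply: sums0.
by apply: (addrI (f 0)); rewrite -fD !addr0.
Qed.

Section Grading.
Context {R : realType} {q : R} (N : nat).
Local Open Scope complex_scope.
Implicit Types a b : disc q.

Lemma homogZ n (c : R[i]) a : homog n a -> homog n (c *: a).
Proof.
by move=> ha; rewrite -[n]add0r -[a]mul1r scalerAl; apply: homog_M => //; apply: homog_C.
Qed.

Lemma homog_1 : homog 0 (1 : disc q).
Proof. by rewrite -(scale1r 1); apply: homog_C. Qed.

Lemma homog_N n a : homog n a -> homog n (- a).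
Proof. by rewrite -[- a]scaleN1r; apply: homogZ. Qed.

Lemma homog_exp n a k : homog n a -> homog (n * k%:Z) (a ^+ k).
Proof.
move=> ha; elim: k => [|k IH]; first by rewrite mulr0; apply: homog_1.
by rewrite exprS -addn1 PoszD mulrDr mulr1 addrC; apply: homog_M.
Qed.

Lemma disc_mod_homog s n a : (n = s %[mod N])%Z -> homog n a -> disc_mod q N s a.
Proof. by move=> ns ha; apply: sums_in; exists n. Qed.

Lemma cone_disc_mod : cone q N = disc_mod q N 0.
Proof.
congr sums; apply/seteqP; split=> a [n nN ha]; exists n => //.
  by rewrite mod0z; apply/dvdz_mod0P.
by move: nN; rewrite mod0z => /dvdz_mod0P.
Qed.

Lemma disc_modM s t a b :
  disc_mod q N s a -> disc_mod q N t b -> disc_mod q N (s + t) (a * b).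
Proof.
move=> ha hb; move: a ha; apply: (@sums_map _ _ _ _ (fun a => a * b)) => [x y|a [m ms ha]].
  by rewrite mulrDl.
move: b hb; apply: sums_map => [x y|b [n nt hb]]; first by rewrite mulrDr.
apply: (disc_mod_homog _ (m + n)); last exact: homog_M.
by rewrite -modzDm ms nt modzDm.
Qed.

Lemma coneM a b : cone q N a -> cone q N b -> cone q N (a * b).
Proof. by rewrite cone_disc_mod -[X in disc_mod _ _ X (a * b)]addr0; apply: disc_modM. Qed.

Lemma cone_homog0 a : homog 0 a -> cone q N a.
Proof. by move=> ha; apply: sums_in; exists 0. Qed.

Lemma coneC (c : R[i]) : cone q N (c%:A : disc q).
Proof. exact/cone_homog0/homog_C. Qed.

Lemma coneZ (c : R[i]) a : cone q N a -> cone q N (c *: a).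
Proof. by move=> ha; rewrite -mulr_algl; apply: coneM => //; apply: coneC. Qed.

Lemma cone0E : cone0 q N = cone q N.
Proof.
apply/seteqP; split=> a.
  move: a; apply: sums_ind => [|x y [a0 [a1 [h0 h1 ->]]]]; first exact: sums0.
  by apply: sumsD; apply: coneM.
move=> ha; apply: sums_in; exists 1, a; rewrite mul1r; split=> //.
by apply/cone_homog0/homog_1.
Qed.

Hypothesis q0 : q != 0.

Lemma homog_sigma n a : homog n a -> homog n (sigma a).
Proof. by move=> ha; rewrite (sigma_homog q0 ha); apply: homogZ. Qed.

Lemma homog_del n a : homog n a -> homog (n - 2) (del a).
Proof.
elim=> {n a} [||c|n|n a b _ ha _ hb|m n a b ha Ha hb Hb].
- by rewrite del_z //; apply: homog_zs.
- by rewrite del_zs //; apply: homog_0.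
- by rewrite delC //; apply: homog_0.
- by rewrite -[X in del X](scale0r (1 : disc q)) delC //; apply: homog_0.
- by rewrite delD //; apply: homog_D.
- rewrite delM //; apply: homog_D.
    by rewrite addrAC; apply: homog_M => //; apply: homog_sigma.
  by rewrite -addrA; apply: homog_M.
Qed.

Lemma homog_delbar n a : homog n a -> homog (n + 2) (delbar a).
Proof.
elim=> {n a} [||c|n|n a b _ ha _ hb|m n a b ha Ha hb Hb].
- by rewrite delbar_z //; apply: homog_0.
- by rewrite delbar_zs //; apply/homogZ/homog_z.
- by rewrite delbarC //; apply: homog_0.
- by rewrite -[X in delbar X](scale0r (1 : disc q)) delbarC //; apply: homog_0.
- by rewrite delbarD //; apply: homog_D.
- rewrite delbarM //; apply: homog_D.
    by rewrite addrAC; apply: homog_M => //; apply: homog_sigma.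
  by rewrite -addrA; apply: homog_M.
Qed.

Lemma homog1_diff n a : homog n a -> homog1 n (diff a).
Proof.
move=> ha; exists (del a), (delbar a).
by split=> //; [apply: homog_del|apply: homog_delbar].
Qed.

Lemma homog1_lact m n a (x : Omega1 q) : homog m a -> homog1 n x -> homog1 (m + n) (a *: x).
Proof.
move=> ha [b [c [hb hc ->]]]; exists (a * b), (a * c); rewrite scalerDr !scalerA -!addrA.
by split=> //; apply: homog_M.
Qed.

Lemma homog1_ract m n a (x : Omega1 q) : homog m a -> homog1 n x -> homog1 (n + m) (ract1 x a).
Proof.
move=> ha [b [c [hb hc ->]]]; rewrite -(Omega1E (b,c)).
exists (b * sigma a), (c * sigma a); rewrite addrAC [n + m + 2]addrAC.
by split=> //; apply: homog_M => //; apply: homog_sigma.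
Qed.

End Grading.

(** * One-forms on the cone *)

Section OneForms.
Context {R : realType} {q : R}.
Local Open Scope complex_scope.
Implicit Types a b : disc q.

Set Implicit Arguments.

(** Data making Z, W play the part of z, z^* and eta, theta that of omega, omega^*
    for the parameter p, with d the degree of Z.  The exchanged pair satisfies the same
    identities with p = 1/q; only the scalars c and c' in dZ and dW differ. *)
Record orientation (d : int) (p c c' : R[i]) (Z W : disc q) (eta theta : Omega1 q) : Prop :=
  Orientation {
  or_p0 : p != 0;
  or_unity : forall k, (0 < k)%N -> p ^+ k != 1;
  or_c : c != 0;
  or_c' : c' != 0;
  or_rel : disc_relation p Z W;
  or_degZ : homog d Z;
  or_degW : homog (- d) W;
  or_sigmaZ : sigma Z = p ^+ 2 *: Z;
  or_sigmaW : sigma W = p ^- 2 *: W;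
  or_diffZ : diff Z = (c *: W) *: eta;
  or_diffW : diff W = (c' *: Z) *: theta;
  or_eta : forall a, ract1 eta a = sigma a *: eta;
  or_theta : forall a, ract1 theta a = sigma a *: theta }.

Unset Implicit Arguments.

Lemma ract1_omega a : ract1 (omega q) a = sigma a *: omega q.
Proof. by rewrite /ract1 mul1r mul0r scale0r addr0. Qed.

Lemma ract1_omegas a : ract1 (omegas q) a = sigma a *: omegas q.
Proof. by rewrite /ract1 mul1r mul0r scale0r add0r. Qed.

Lemma real_complexX (x : R) n : (x ^+ n)%:C = x%:C ^+ n.
Proof. exact: rmorphXn. Qed.

Lemma real_complexV (x : R) : (x^-1)%:C = x%:C^-1.
Proof. exact: fmorphV. Qed.

Lemma real_complexM (x y : R) : (x * y)%:C = x%:C * y%:C.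
Proof. exact: rmorphM. Qed.

Lemma real_complexB1 (x : R) : (x - 1)%:C = x%:C - 1.
Proof. by rewrite rmorphB. Qed.

Lemma real_complex1B (x : R) : (1 - x)%:C = 1 - x%:C.
Proof. by rewrite rmorphB. Qed.

Lemma expr_lt1_neq1 (x : R) : 0 < x < 1 -> forall k, (0 < k)%N -> x ^+ k != 1.
Proof.
move=> /andP[x0 x1] k k0; by rewrite lt_eqF // exprn_ilt1 ?(ltW x0) // -lt0n.
Qed.

Hypothesis hq : 0 < q < 1.

Let q0 : q != 0. Proof. by case/andP: hq => /lt0r_neq0. Qed.

Let qC0 : q%:C != 0. Proof. by rewrite fmorph_eq0. Qed.

Let qC_unity k : (0 < k)%N -> q%:C ^+ k != 1.
Proof. by move=> k0; rewrite -real_complexX fmorph_eq1 expr_lt1_neq1. Qed.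

Lemma disc_relation_z : disc_relation q%:C (dz q) (dzs q).
Proof. by rewrite /disc_relation -real_complexX -real_complex1B -disc_rel addrC subrK. Qed.

Lemma orientation_z : orientation 1 q%:C 1 (q%:C ^+ 2) (dz q) (dzs q) (omega q) (omegas q).
Proof.
split; rewrite ?oner_neq0 ?expf_neq0 //.
- exact: disc_relation_z.
- exact: homog_z.
- exact: homog_zs.
- by rewrite sigma_z // real_complexX.
- by rewrite sigma_zs // real_complexV real_complexX.
- by rewrite /diff del_z // delbar_z // scale0r addr0 scale1r.
- by rewrite /diff del_zs // delbar_zs // scale0r add0r real_complexX.
- exact: ract1_omega.
- exact: ract1_omegas.
Qed.

Lemma orientation_zs :
  orientation (-1) q%:C^-1 (q%:C ^+ 2) 1 (dzs q) (dz q) (omegas q) (omega q).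
Proof.
split; rewrite ?oner_neq0 ?invr_eq0 ?expf_neq0 //.
- by move=> k k0; rewrite exprVn invr_eq1 qC_unity.
- exact: disc_relation_swap disc_relation_z qC0.
- exact: homog_zs.
- exact: homog_z.
- by rewrite sigma_zs // real_complexV real_complexX exprVn.
- by rewrite sigma_z // real_complexX exprVn invrK.
- by rewrite /diff del_zs // delbar_zs // scale0r add0r real_complexX.
- by rewrite /diff del_z // delbar_z // scale0r addr0 scale1r.
- exact: ract1_omegas.
- exact: ract1_omega.
Qed.

Lemma ract1_1 (x : Omega1 q) : ract1 x 1 = x.
Proof.
by rewrite ract1E -(scale1r 1) sigmaC // scale1r !mulr1; case: x.
Qed.

Lemma ract1_ract1 (x : Omega1 q) a b : ract1 (ract1 x a) b = ract1 x (a * b).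
Proof. by rewrite !ract1E /= sigmaM // !mulrA. Qed.

Lemma ract1N (x : Omega1 q) a : ract1 (- x) a = - ract1 x a.
Proof. by rewrite !ract1E /= !mulNr. Qed.

Lemma diffD a b : diff (a + b) = diff a + diff b.
Proof. by rewrite !diffE delD // delbarD. Qed.

Lemma diffC (c : R[i]) : diff (c%:A : disc q) = 0.
Proof. by rewrite diffE delC // delbarC. Qed.

Lemma diff1 : diff (1 : disc q) = 0.
Proof. by rewrite -(scale1r 1) diffC. Qed.

Lemma diffB a b : diff (a - b) = diff a - diff b.
Proof. by apply: (addIr (diff b)); rewrite -diffD !subrK. Qed.

Lemma sigma_homog0 {a} : homog 0 a -> sigma a = a.
Proof. by move=> ha; rewrite (sigma_homog q0 ha) mulr0 expr0z scale1r. Qed.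

Section ConeForms.
Variable N : nat.

Lemma cone1_diff a : cone q N a -> cone1 q N (diff a).
Proof.
move=> ha; apply: sums_in; exists 1, a, 1; rewrite scale1r ract1_1.
by split=> //; apply/cone_homog0/homog_1.
Qed.

Lemma cone1_lact a (x : Omega1 q) : cone q N a -> cone1 q N x -> cone1 q N (a *: x).
Proof.
move=> ha; move: x; apply: sums_map => [x y|_ [b0 [b1 [b2 [h0 h1 h2 ->]]]]].
  by rewrite scalerDr.
apply: sums_in; exists (a * b0), b1, b2; rewrite -scalerA !ract1Z.
by split=> //; apply: coneM.
Qed.

Lemma cone1_ract a (x : Omega1 q) : cone q N a -> cone1 q N x -> cone1 q N (ract1 x a).
Proof.
move=> ha; move: x; apply: (@sums_map _ _ _ _ (fun x => ract1 x a)).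
  by move=> x y; rewrite ract1D.
move=> _ [b0 [b1 [b2 [h0 h1 h2 ->]]]].
apply: sums_in; exists b0, b1, (b2 * a); rewrite ract1_ract1.
by split=> //; apply: coneM.
Qed.

End ConeForms.

Section Orientation.
Context {d : int} {p c c' : R[i]} {Z W : disc q} {eta theta : Omega1 q}.
Hypothesis o : orientation d p c c' Z W eta theta.
Let rel := or_rel o.
Let p0 := or_p0 o.
Local Notation X := (defect Z W).
Local Notation at_defect := (at_defect Z W).

Lemma homog_defect : homog 0 X.
Proof.
rewrite defectE; apply: homog_D; first exact: homog_1.
by apply: homog_N; rewrite -(subrr d); apply: homog_M; [exact: or_degZ o|exact: or_degW o].
Qed.

Lemma homog_at_defect f : homog 0 (at_defect f).
Proof.
elim/poly_ind: f => [|f e IH]; first by rewrite -(scale0r 0) at_defectZ scale0r; apply: homog_0.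
rewrite at_defectD at_defectM at_defectX at_defectC; apply: homog_D; last exact: homog_C.
by rewrite -[0](addr0 0); apply: homog_M => //; apply: homog_defect.
Qed.

Lemma ract1_eta a b : ract1 (a *: eta) b = (a * sigma b) *: eta.
Proof. by rewrite ract1Z (or_eta o) scalerA. Qed.

Lemma ract1_theta a b : ract1 (a *: theta) b = (a * sigma b) *: theta.
Proof. by rewrite ract1Z (or_theta o) scalerA. Qed.

Lemma diff_exp n : diff (Z ^+ n.+2) = (c *: (Z ^+ n * at_defect (exp_poly p n.+2))) *: eta.
Proof.
elim: n => [|n IH].
  rewrite expr2 diffM // (or_diffZ o) ract1_eta (or_sigmaZ o) scalerA -scalerDl.
  congr (_ *: _); rewrite -!scalerAl -!scalerAr -scalerDr; congr (_ *: _).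
  rewrite (mul_WZ rel) mul_ZW expr0 mul1r /exp_poly !big_ord_recl !big_ord0.
  rewrite at_defectB at_defectZ at_defectC at_defectX.
  rewrite !expr0 !addr0 !expr1 !scalerDl !scale1r scalerBr scalerA addrACA opprD -exprD.
  by rewrite addrC [in LHS](addrC _ 1) [in RHS](addrC _ (- _)) addrC.
rewrite [Z ^+ n.+3]exprSr diffM // IH (or_diffZ o) ract1_eta (or_sigmaZ o) scalerA -scalerDl.
by rewrite -[_ * (c *: W)]scalerAr -scalerAl -scalerDr (exp_poly_step rel).
Qed.

(** The defect has both a theta and an eta component in its differential; they are
    separated by comparing the left and the right multiplication by X. *)
Lemma diff_defect :
  diff X = - ((c * p ^- 2 *: W ^+ 2) *: eta + (c' *: Z ^+ 2) *: theta).
Proof.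
rewrite defectE diffB diff1 sub0r diffM // (or_diffZ o) (or_diffW o) ract1_eta.
rewrite (or_sigmaW o) scalerA -!scalerAl -!scalerAr scalerA -!expr2.
by [].
Qed.

(** X Z^2 = p^4 Z^2 X whereas X W^2 = p^-4 W^2 X, so X dX - p^4 dX X has no theta
    component, and its eta component is a nonzero multiple of W^2 X because p^8 != 1. *)
Lemma cone1_W2_defect N : cone1 q N ((W ^+ 2 * X) *: eta).
Proof.
have hX : cone q N X by apply/cone_homog0/homog_defect.
have h1 : cone1 q N (X *: diff X) by apply/cone1_lact/cone1_diff.
have h2 : cone1 q N (ract1 (diff X) X) by apply/cone1_ract/cone1_diff.
(* - c k is the coefficient of (W^2 X) eta in X dX - p^4 dX X *)
set k := p ^- 2 * (p ^- 4 - p ^+ 4).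
have k0 : c * k != 0.
  rewrite mulf_neq0 ?(or_c o) // mulf_neq0 ?invr_eq0 ?expf_neq0 //.
  have -> : p ^- 4 - p ^+ 4 = p ^- 4 * (1 - p ^+ 8) by field.
  by rewrite mulf_neq0 ?invr_eq0 ?expf_neq0 // subr_eq0 eq_sym (or_unity o).
suff -> : (W ^+ 2 * X) *: eta
    = ((- (c * k)^-1)%:A : disc q) *: (X *: diff X - ((p ^+ 4)%:A : disc q) *: ract1 (diff X) X).
  apply: cone1_lact; first exact: coneC.
  by apply: sumsD => //; rewrite -scaleNr; apply: cone1_lact => //; rewrite -scaleNr; apply: coneC.
have -> : X *: diff X = - ((c * p ^- 2 * p ^- 4 *: (W ^+ 2 * X)) *: eta
                           + (c' * p ^+ 4 *: (Z ^+ 2 * X)) *: theta).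
  rewrite diff_defect scalerN scalerDr !scalerA -!scalerAr.
  by rewrite (defectZn rel) (defectWn rel p0) !scalerA.
have -> : ract1 (diff X) X = - ((c * p ^- 2 *: (W ^+ 2 * X)) *: eta
                               + (c' *: (Z ^+ 2 * X)) *: theta).
  rewrite diff_defect ract1N ract1D ract1_eta ract1_theta.
  by rewrite (sigma_homog0 homog_defect) -!scalerAl.
rewrite scalerN opprK (scalerDr (p ^+ 4)%:A) opprD addrACA 2!(scalerA (p ^+ 4)%:A).
rewrite !mulr_algl 2!(scalerA (p ^+ 4)) (mulrC c') addNr addr0 -scaleNr -scaleNr -!scalerDl.
rewrite scalerA mulr_algl scalerA.
have -> : - (c * p ^- 2 * p ^- 4) + p ^+ 4 * (c * p ^- 2) = - (c * k) by rewrite /k; field.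
by rewrite mulrNN mulVf // !scale1r.
Qed.

(** A Bezout relation 1 = u G + v K between the two coprime polynomials splits a eta as
    a G(X) u(X) eta + a K(X) v(X) eta, and each summand is visibly in Omega^1(C). *)
Lemma cone1_eta n a : disc_mod q n.+2 (- (d *+ 2)) a -> cone1 q n.+2 (a *: eta).
Proof.
move=> ha; set N := n.+2.
have /Bezout_eq1_coprimepP [[u v] /= uv] := root_poly_coprime p0 (or_unity o) n.
have cev f : cone q N (at_defect f) by apply/cone_homog0/homog_at_defect.
have evE b f : (b * at_defect f) *: eta = ract1 (b *: eta) (at_defect f).
  by rewrite ract1_eta (sigma_homog0 (homog_at_defect f)).
have modZ k b s : homog s b -> (s = k %[mod N])%Z -> disc_mod q N k b.
  by move=> hb hs; apply: disc_mod_homog hs hb.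
have hG : cone1 q N ((a * at_defect (root_poly p n) * at_defect u) *: eta).
  rewrite evE; apply: cone1_ract => //.
  have -> : (a * at_defect (root_poly p n)) *: eta = (c^-1 *: (a * W ^+ n)) *: diff (Z ^+ N).
    rewrite diff_exp scalerA -scalerAl -scalerAr scalerA mulVf ?(or_c o) // scale1r.
    by rewrite at_defectM -(WnZn rel) !mulrA.
  apply: cone1_lact.
    apply: coneZ; rewrite cone_disc_mod.
    rewrite -(subrr (- (d *+ 2))).
    apply: disc_modM => //; apply: (modZ _ _ _ (homog_exp _ _ _ (or_degW o))).
    have -> : - d * n%:Z = - d * N%:Z + d *+ 2 by rewrite /N -addn2 PoszD; ring.
    by rewrite modzMDl opprK.
  apply: cone1_diff; rewrite cone_disc_mod.
  apply: (modZ _ _ _ (homog_exp _ _ _ (or_degZ o))).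
  by rewrite modzMl mod0z.
have hK : cone1 q N ((a * at_defect ('X * ('X - 1) * ('X - (p ^+ 2)%:P)) * at_defect v) *: eta).
  rewrite evE; apply: cone1_ract => //.
  have -> : at_defect ('X * ('X - 1) * ('X - (p ^+ 2)%:P)) = p ^+ 2 *: (Z ^+ 2 * (W ^+ 2 * X)).
    have -> : 'X * ('X - 1) * ('X - (p ^+ 2)%:P)
        = p ^+ 2 *: ((1 - 'X) * (1 - p ^- 2 *: 'X) * 'X).
      have : (p ^+ 2)%:P * (p ^- 2)%:P = 1 :> {poly R[i]}.
        by rewrite -polyCM mulfV ?expf_neq0.
      rewrite -!mul_polyC; move: (p ^+ 2)%:P (p ^- 2)%:P => e e' ee.
      have E : e * (1 - e' * 'X) = e - 'X by rewrite mulrBr mulr1 mulrA ee mul1r.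
      by rewrite !mulrA (mulrC e) -(mulrA (1 - 'X)) E; ring.
    rewrite at_defectZ !at_defectM !at_defectB at_defect1 at_defectZ at_defectX.
    by rewrite -(Z2W2 rel p0) mulrA.
  rewrite -scalerAr (mulrA a) scalerAl -scalerA; apply: cone1_lact; last exact: cone1_W2_defect.
  apply: coneZ; rewrite cone_disc_mod -(addNr (d *+ 2)).
  apply: disc_modM => //; apply: (modZ _ _ _ (homog_exp _ _ _ (or_degZ o))).
  by congr modz; rewrite mulr2n; lia.
rewrite -[a]mulr1 -(@at_defect1 _ _ Z W) -uv at_defectD mulrDr scalerDl.
rewrite [u * _]mulrC [v * _]mulrC (at_defectM _ u) (at_defectM _ v) (mulrA a) (mulrA a).
by apply: sumsD.
Qed.

(** If X kills t then so does X W^k for every k, and Z W = 1 - X acts as the identity. *)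
Lemma defect_act (V : lmodType (disc q)) (t : V) n : X *: t = 0 -> (Z ^+ n * W ^+ n) *: t = t.
Proof.
move=> Xt; elim: n => [|n IH]; first by rewrite mulr1 scale1r.
rewrite exprSr exprS -mulrA (mulrA Z) (@mul_ZW _ _ Z W) mulrBl mul1r (defectWn rel p0) mulrBr.
by rewrite scalerBl IH -scalerAr mulrA scalerAl -[X in _ - X]scalerA Xt scaler0 subr0.
Qed.

End Orientation.

(** * Two-forms on the disc *)

Lemma wedgeDl (x y t : Omega1 q) : wedge (x + y) t = wedge x t + wedge y t.
Proof. by rewrite /wedge tensDl cls2D. Qed.

Lemma wedgeDr (t x y : Omega1 q) : wedge t (x + y) = wedge t x + wedge t y.
Proof. by rewrite /wedge tensDr cls2D. Qed.

Lemma scale_wedge a (x y : Omega1 q) : wedge (a *: x) y = a *: wedge x y.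
Proof. by rewrite /wedge scale_cls2 scale_tens. Qed.

Lemma wedge_balanced (x : Omega1 q) a (y : Omega1 q) : wedge (ract1 x a) y = wedge x (a *: y).
Proof. by rewrite /wedge tens_balanced. Qed.

Lemma ract2_wedge (x y : Omega1 q) a : ract2 (wedge x y) a = wedge x (ract1 y a).
Proof. by rewrite /wedge ract2_cls ract11_tens. Qed.

Lemma ract2D (u v : Omega2 q) a : ract2 (u + v) a = ract2 u a + ract2 v a.
Proof. by rewrite -(rep2K u) -(rep2K v) -cls2D !ract2_cls ract11D cls2D. Qed.

Lemma ract2Z b (u : Omega2 q) a : ract2 (b *: u) a = b *: ract2 u a.
Proof.
rewrite -(rep2K u) scale_cls2 !ract2_cls scale_cls2; congr cls2.
move: (rep2 u); apply: Omega11_ind => [x y||v hv|v w hv hw].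
- by rewrite scale_tens !ract11_tens scale_tens.
- by rewrite scaler0 !ract11_0 scaler0.
- by rewrite scalerN !ract11N scalerN hv.
- by rewrite scalerDr !ract11D scalerDr hv hw.
Qed.

Lemma wedge_scale a b (x y : Omega1 q) : (forall b, ract1 x b = sigma b *: x) ->
  wedge (a *: x) (b *: y) = (a * sigma b) *: wedge x y.
Proof. by move=> hx; rewrite -wedge_balanced ract1Z hx scalerA scale_wedge. Qed.

Lemma wedge0r (x : Omega1 q) : wedge x 0 = 0.
Proof. by apply: (addrI (wedge x 0)); rewrite -wedgeDr !addr0. Qed.

Lemma wedge0l (x : Omega1 q) : wedge 0 x = 0.
Proof. by apply: (addrI (wedge 0 x)); rewrite -wedgeDl !addr0. Qed.

Lemma ract2_0 a : ract2 (0 : Omega2 q) a = 0.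
Proof. by apply: (addrI (ract2 0 a)); rewrite -ract2D !addr0. Qed.

Lemma diff0 : diff (0 : disc q) = 0.
Proof. by rewrite -(subrr 0) diffB subrr. Qed.

Lemma diffN a : diff (- a) = - diff a.
Proof. by rewrite -sub0r diffB diff0 sub0r. Qed.

Lemma wedgeNl (x y : Omega1 q) : wedge (- x) y = - wedge x y.
Proof. by rewrite -scaleN1r scale_wedge scaleN1r. Qed.

(** The graph of the exterior derivative on Omega^1.  That it is the graph of a function
    ([dext_inj]) is exactly the defining relation of the maximal prolongation, so every
    identity between one-forms may be differentiated. *)
Definition dext (x : Omega1 q) (w : Omega2 q) : Prop :=
  exists s : seq (disc q * disc q), x = \sum_(t <- s) t.1 *: diff t.2 /\
    w = \sum_(t <- s) wedge (diff t.1) (diff t.2).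

Lemma dextD x y v w : dext x v -> dext y w -> dext (x + y) (v + w).
Proof. by move=> [s [-> ->]] [t [-> ->]]; exists (s ++ t); rewrite !big_cat. Qed.

Lemma dext_diff a : dext (diff a) 0.
Proof.
exists [:: (1, a)]; rewrite !big_seq1 scale1r /= diff1; split=> //.
by rewrite wedge0l.
Qed.

Lemma dext_lact a x w : dext x w -> dext (a *: x) (wedge (diff a) x + a *: w).
Proof.
move=> [s [-> ->]]; exists [seq (a * t.1, t.2) | t <- s]; rewrite !big_map /=.
split; first by rewrite scaler_sumr; apply: eq_bigr => t _; rewrite scalerA.
elim: s => [|t s IH]; first by rewrite !big_nil wedge0r scaler0 addr0.
rewrite !big_cons wedgeDr (scalerDr a) -IH diffM // wedgeDl scale_wedge wedge_balanced.
by rewrite addrACA.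
Qed.

Lemma dext_ract a x w : dext x w -> dext (ract1 x a) (ract2 w a - wedge x (diff a)).
Proof.
move=> [s [-> ->]].
(* (u dv) a = u d(v a) - u v da *)
exists (flatten [seq [:: (t.1, t.2 * a); (- (t.1 * t.2), a)] | t <- s]).
elim: s => [|t s [IH1 IH2]].
  rewrite !big_nil; split; first by rewrite ract1E !mul0r.
  by rewrite ract2_0 wedge0l subr0.
rewrite /= !big_cons /=; split.
  rewrite ract1D IH1 ract1Z diffM // addrA; congr (_ + _).
  by rewrite (scalerDr _ (ract1 _ _)) scalerA scaleNr -addrA subrr addr0.
rewrite ract2D (wedgeDl (_ *: diff _)) opprD addrACA IH2 addrA; congr (_ + _).
rewrite ract2_wedge /= diffN wedgeNl.
rewrite !diffM // (wedgeDr _ (ract1 _ _)) (wedgeDl (ract1 _ _)) opprD.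
by rewrite wedge_balanced !scale_wedge addrA addrK.
Qed.

Lemma dext0 w : dext 0 w -> w = 0.
Proof.
move=> [s [s0 ->]]; have := prolong_gen (esym s0).
rewrite -[X in prolong X]subr0 => /cls2P.
have cls20 : cls2 (0 : Omega11 q) = 0 by apply: (addrI (cls2 0)); rewrite -cls2D !addr0.
rewrite cls20 => E; rewrite -[RHS]E {s0 E}.
elim: s => [|t s IH]; first by rewrite !big_nil cls20.
by rewrite !big_cons cls2D IH.
Qed.

Lemma dext_inj x v w : dext x v -> dext x w -> v = w.
Proof.
move=> hv hw; apply/eqP; rewrite -subr_eq0; apply/eqP/dext0.
have := dextD _ _ _ _ hv (dext_lact (- 1) _ _ hw).
by rewrite !scaleN1r subrr diffN diff1 oppr0 wedge0l add0r.
Qed.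

Lemma diffZ (c : R[i]) a : diff (c *: a) = (c%:A : disc q) *: diff a.
Proof.
rewrite -[in LHS]mulr_algl diffM // diffC ract1E !mul0r.
by rewrite -[RHS]add0r.
Qed.

Lemma dext_scale (e : R[i]) x w : dext x w -> dext ((e%:A : disc q) *: x) ((e%:A : disc q) *: w).
Proof. by move=> /(dext_lact (e%:A)); rewrite diffC wedge0l add0r. Qed.

Section Relations.
Context {d : int} {p c c' : R[i]} {Z W : disc q} {eta theta : Omega1 q}.
Hypothesis o : orientation d p c c' Z W eta theta.
Let rel := or_rel o.
Let p0 := or_p0 o.
Local Notation X := (defect Z W).

Lemma mulrZZ (e f : R[i]) a b : (e *: a) * (f *: b) = (e * f) *: (a * b).
Proof. by rewrite -scalerAl -scalerAr scalerA. Qed.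

Lemma scale_cancel {V : lmodType (disc q)} (e : R[i]) a b (t u : V) : e != 0 ->
  (e *: a) *: t = (e *: b) *: u -> a *: t = b *: u.
Proof.
move=> e0 /(congr1 (fun w => ((e^-1)%:A : disc q) *: w)).
by rewrite !scalerA !mulr_algl !scalerA mulVf // !scale1r.
Qed.

Lemma scaleAZ {V : lmodType (disc q)} (e : R[i]) a (t : V) :
  (e *: a) *: t = (e%:A : disc q) *: (a *: t).
Proof. by rewrite scalerA mulr_algl. Qed.

(** The commutation rule obeyed by every product of two of the generators of Omega^1. *)
Definition twisted (t : Omega2 q) := forall a, ract2 t a = sigma (sigma a) *: t.

Lemma wedge_twisted (x y : Omega1 q) : (forall a, ract1 x a = sigma a *: x) ->
  (forall a, ract1 y a = sigma a *: y) -> twisted (wedge x y).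
Proof. by move=> hx hy a; rewrite ract2_wedge hy -wedge_balanced hx scale_wedge. Qed.

Lemma sigmaZ (e : R[i]) a : sigma (e *: a) = e *: sigma a.
Proof. by rewrite -[in LHS]mulr_algl sigmaM // sigmaC // mulr_algl. Qed.

Lemma sigma2Z : sigma (sigma Z) = p ^+ 4 *: Z.
Proof. by rewrite (or_sigmaZ o) sigmaZ (or_sigmaZ o) scalerA -exprD. Qed.

Lemma sigma2W : sigma (sigma W) = p ^- 4 *: W.
Proof. by rewrite (or_sigmaW o) sigmaZ (or_sigmaW o) scalerA -invfM -exprD. Qed.

(* p^4 = -1 would make p a root of unity *)
Let p4 : 1 + p ^+ 4 != 0.
Proof.
apply/eqP => p4; have := or_unity o 8 isT.
by rewrite (_ : p ^+ 8 = 1) ?eqxx //; move/eqP: p4; rewrite addrC addr_eq0 => /eqP p4;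
  rewrite (exprM p 4 2) p4 sqrrN expr1n.
Qed.

Let p2 : 1 - p ^+ 2 != 0.
Proof. by rewrite subr_eq0 eq_sym (or_unity o). Qed.

(** Multiplying the hypothesis on the left and on the right by W gives W Z t = Z W t,
    while W Z - Z W = (1 - p^2) X. *)
Lemma twisted_transfer (t u : Omega2 q) (n : R[i]) : twisted t -> twisted u ->
  Z *: t = (n *: W ^+ 3) *: u -> X *: t = 0 /\ t = (n *: W ^+ 4) *: u.
Proof.
move=> ht hu E.
have E1 : (W * Z) *: t = (n *: W ^+ 4) *: u.
  by rewrite -scalerA E scalerA -scalerAr -exprS.
have E2 : (Z * W) *: t = (n *: W ^+ 4) *: u.
  apply: (@scale_cancel _ (p ^- 4)); first by rewrite invr_eq0 expf_neq0.
  have := congr1 (fun w => ract2 w W) E; rewrite !ract2Z ht hu !scalerA sigma2W.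
  by rewrite -!scalerAr -!scalerAl -exprSr !scalerA.
have X0 : X *: t = 0.
  rewrite -[RHS](scale0r t).
  apply: (@scale_cancel _ (1 - p ^+ 2)); first by [].
  have -> : (1 - p ^+ 2) *: X = W * Z - Z * W.
    rewrite (mul_WZ rel) mul_ZW opprB scalerBl scale1r.
    by rewrite [RHS]addrC addrA subrK.
  by rewrite scalerBl E1 E2 subrr scaler0 scale0r.
by split=> //; rewrite -E2 mul_ZW scalerBl X0 scale1r subr0.
Qed.

(** d(eta) = - deta_coef W^2 eta eta.  Locked to keep scalar rewriting out of it. *)
Definition deta_coef := locked (c * (1 + p ^+ 4) / (p ^+ 4 * (1 - p ^+ 2))).

Lemma deta_coefE : deta_coef = c * (1 + p ^+ 4) / (p ^+ 4 * (1 - p ^+ 2)).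
Proof. by rewrite /deta_coef -lock. Qed.

(** The form eta is the multiple (dZ Z - p^4 Z dZ) / (c p^2 (1 - p^2)), whose derivative is
    a multiple of dZ dZ. *)
Lemma dext_eta : dext eta ((- deta_coef *: W ^+ 2) *: wedge eta eta).
Proof.
have [k Ek Em] : exists2 k, k * (c * (p ^+ 2 * (1 - p ^+ 2))) = 1
    & - deta_coef = k * (- (c * (c * p ^- 2)) - p ^+ 4 * (c * (c * p ^- 2))).
  have c0 := or_c o; exists (c * (p ^+ 2 * (1 - p ^+ 2)))^-1.
    by rewrite mulVf // !mulf_neq0 ?expf_neq0.
  by rewrite deta_coefE; field; rewrite c0 p0 p2.
(* naming the coefficient keeps it out of reach of the scalar rewritings below *)
move: (- deta_coef) Em => e Em.
rewrite [X in dext X](_ : _ = (k%:A : disc q) *: (ract1 (diff Z) Z + - (p ^+ 4 *: Z) *: diff Z));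
  last first.
  rewrite (or_diffZ o) (ract1_eta o) (or_sigmaZ o) scalerA -scalerDl scalerA.
  rewrite -[LHS]scale1r; congr (_ *: _).
  have -> : c *: W * (p ^+ 2 *: Z) + - (p ^+ 4 *: Z) * (c *: W)
      = (c * (p ^+ 2 * (1 - p ^+ 2))) *: 1.
    have -> : c * (p ^+ 2 * (1 - p ^+ 2)) = p ^+ 2 * c - c * p ^+ 4 by ring.
    rewrite -!scalerAr mulNr -!scalerAl (mul_WZ rel) (@mul_ZW _ _ Z W).
    rewrite !scalerBr scalerN scalerBr opprB !scalerA addrA.
    have -> : p ^+ 2 * c * p ^+ 2 = c * p ^+ 4 by ring.
    by rewrite subrK -scalerBl.
  by rewrite mulr_algl scalerA Ek scale1r.
have E : (e *: W ^+ 2) *: wedge eta eta = (k%:A : disc q) *: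
    (ract2 0 Z - wedge (diff Z) (diff Z) + (wedge (diff (- (p ^+ 4 *: Z))) (diff Z)
       + - (p ^+ 4 *: Z) *: 0)).
  rewrite ract2_0 sub0r scaler0 addr0 diffN diffZ wedgeNl scale_wedge (or_diffZ o).
  rewrite (wedge_scale _ _ _ _ (or_eta o)) sigmaZ (or_sigmaW o).
  rewrite (scalerA (p ^+ 4)%:A) -!scaleNr -scalerDl scalerA !mulr_algl; congr (_ *: _).
  by rewrite scalerA mulrZZ -expr2 !scalerA -!(scaleNr _ (W ^+ 2)) -scalerDl scalerA Em.
rewrite E.
apply: dext_scale; apply: dextD; first exact: dext_ract (dext_diff Z).
exact: dext_lact (dext_diff Z).
Qed.

Local Notation ee := (wedge eta eta).

(** The derivative of dZ = c W eta. *)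
Lemma rel_theta_eta : Z *: wedge theta eta = ((deta_coef / c') *: W ^+ 3) *: ee.
Proof.
have h1 := dext_diff Z; rewrite (or_diffZ o) in h1.
have := dext_inj _ _ _ h1 (dext_lact (c *: W) _ _ dext_eta).
rewrite diffZ (or_diffW o) scalerA scale_wedge scalerA mulr_algl mulrZZ -exprS.
rewrite scalerA mulrN => /esym/eqP; rewrite scaleNr scaleNr subr_eq0 => /eqP E.
apply: (@scale_cancel _ (c * c')); first by rewrite mulf_neq0 ?(or_c o) ?(or_c' o).
rewrite E scalerA; congr ((_ *: _) *: _).
by field; rewrite (or_c' o).
Qed.

(** The derivative of eta W = p^-2 W eta. *)
Lemma rel_eta_theta : Z *: wedge eta theta = (- (deta_coef / (c' * p ^+ 6)) *: W ^+ 3) *: ee.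
Proof.
have h1 := dext_ract W _ _ dext_eta; rewrite (or_eta o) (or_sigmaW o) in h1.
have := dext_inj _ _ _ h1 (dext_lact (p ^- 2 *: W) _ _ dext_eta).
rewrite ract2Z (wedge_twisted _ _ (or_eta o) (or_eta o)) sigma2W scalerA.
rewrite diffZ (or_diffW o) -wedge_balanced (or_eta o) sigmaZ (or_sigmaZ o).
rewrite !scale_wedge.
have c'0 := or_c' o; move: deta_coef rel_theta_eta => m Et.
rewrite [(c' *: Z) *: _]scaleAZ Et (scalerA c'%:A) mulr_algl (scalerA (p ^- 2)%:A) mulr_algl.
rewrite (scalerA _ _ ee) !mulrZZ.
rewrite -exprS -exprSr !scalerA -scalerDl -scalerDl.
have -> : p ^- 2 * c' * (m / c') + p ^- 2 * - m = 0 by field; rewrite p0 c'0.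
rewrite !scale0r => /eqP; rewrite subr_eq0 => /eqP E; apply/esym.
apply: (@scale_cancel _ (c' * p ^+ 2)); first by rewrite mulf_neq0 ?expf_neq0.
by rewrite -E scalerA; congr ((_ *: _) *: _); field; rewrite p0 c'0.
Qed.

Lemma deta_coef_eq : deta_coef * (p ^+ 4 * (1 - p ^+ 2)) = c * (1 + p ^+ 4).
Proof. by rewrite deta_coefE divfK // mulf_neq0 ?expf_neq0. Qed.

Lemma deta_coef_neq0 : deta_coef != 0.
Proof. by rewrite deta_coefE !mulf_neq0 ?invr_eq0 ?mulf_neq0 ?expf_neq0 // (or_c o). Qed.

(** The derivative of eta Z = p^2 Z eta gives W X eta eta = 0.  Multiplying by Z on the
    left and on the right, (1 - X) X and (1 - p^2 X) X both kill eta eta. *)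
Lemma defect_eta_eta : X *: ee = 0.
Proof.
have h1 := dext_ract Z _ _ dext_eta; rewrite (or_eta o) (or_sigmaZ o) in h1.
have := dext_inj _ _ _ h1 (dext_lact (p ^+ 2 *: Z) _ _ dext_eta).
rewrite ract2Z (wedge_twisted _ _ (or_eta o) (or_eta o)) sigma2Z scalerA.
rewrite diffZ (or_diffZ o) -wedge_balanced (or_eta o) sigmaZ (or_sigmaW o).
rewrite !scale_wedge.
move: deta_coef_neq0 deta_coef_eq; move: deta_coef => m m0 mE.
rewrite !scalerA mulr_algl !mulrZZ !scalerA.
rewrite -scalerBl -scalerDl => /eqP; rewrite -subr_eq0 -scalerBl => /eqP E.
have E1 : (W * X) *: ee = 0.
  rewrite -[RHS](scale0r ee); apply: (@scale_cancel _ (m * (p ^+ 6 - 1))).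
    by rewrite mulf_neq0 // subr_eq0 (or_unity o).
  rewrite scaler0 scale0r -[RHS]E; congr (_ *: _).
  have -> : W ^+ 2 * Z = W - p ^+ 2 *: (W * X).
    by rewrite expr2 -mulrA (mul_WZ rel) mulrBr mulr1 -scalerAr.
  have -> : Z * W ^+ 2 = W - p ^- 2 *: (W * X).
    by rewrite expr2 mulrA (@mul_ZW _ _ Z W) mulrBl mul1r (defectW rel p0).
  move: (W * X) => V; rewrite !scalerBr !scalerA.
  rewrite opprD opprB addrA [_ - _ - c / _ *: W]addrAC [_ - _ - (p ^+ 2 * c) *: W]addrAC.
  rewrite [X in _ = _ + X]addrC addrACA -scalerBl -scalerBl -scalerBl
    -[- _ + _ *: V]addrC -scalerBl.
  have -> : - m * p ^+ 4 - c / p ^+ 2 - p ^+ 2 * c - p ^+ 2 * - m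
      = (m * (p ^+ 4 * (1 - p ^+ 2)) - c * (1 + p ^+ 4)) / p ^+ 2 by field.
  rewrite mE subrr mul0r scale0r add0r; congr (_ *: _); field.
  by [].
have E2 : ((1 - X) * X) *: ee = 0 by rewrite -mul_ZW -mulrA -scalerA E1 scaler0.
have E3 : ((1 - p ^+ 2 *: X) * X) *: ee = 0.
  have := congr1 (fun w => ract2 w Z) E1.
  rewrite ract2Z (wedge_twisted _ _ (or_eta o) (or_eta o)) sigma2Z scalerA ract2_0.
  rewrite -scalerAr -(mulrA W) (defectZ rel) -scalerAr scalerA (mulrA W) (mul_WZ rel).
  move=> E3; rewrite -[RHS](scale0r ee).
  apply: (@scale_cancel _ (p ^+ 4 * p ^+ 2)); first by rewrite mulf_neq0 ?expf_neq0.
  by rewrite E3 scaler0 scale0r.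
have : ((p ^+ 2 - 1) *: X) *: ee = (p ^+ 2 *: ((1 - X) * X) - (1 - p ^+ 2 *: X) * X) *: ee.
  congr (_ *: _); rewrite !mulrBl !mul1r scalerBr -scalerAl opprB addrA subrK.
  by rewrite scalerBl scale1r.
rewrite [RHS]scalerBl E3 subr0 [RHS]scaleAZ E2 scaler0 => E4; rewrite -[RHS](scale0r ee).
apply: (@scale_cancel _ (p ^+ 2 - 1)); first by rewrite subr_eq0 (or_unity o).
by rewrite E4 scaler0 scale0r.
Qed.

(** Both mixed products are multiples of W^4 eta eta, and Z^4 W^4 acts as the identity on
    eta eta. *)
Lemma eta_theta_structure :
  [/\ X *: wedge eta theta = 0,
      wedge theta eta = ((- p ^+ 6)%:A : disc q) *: wedge eta theta
    & exists k : R[i], ee = (k *: Z ^+ 4) *: wedge eta theta].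
Proof.
have [_ te] := twisted_transfer _ _ _ (wedge_twisted _ _ (or_theta o) (or_eta o))
  (wedge_twisted _ _ (or_eta o) (or_eta o)) rel_theta_eta.
have [X0 et] := twisted_transfer _ _ _ (wedge_twisted _ _ (or_eta o) (or_theta o))
  (wedge_twisted _ _ (or_eta o) (or_eta o)) rel_eta_theta.
have m0 := deta_coef_neq0; have c'0 := or_c' o; move: deta_coef m0 te et => m m0 te et.
split=> //.
  rewrite te et scalerA mulr_algl scalerA; congr ((_ *: _) *: _); field.
  by rewrite p0 c'0.
exists (- (m / (c' * p ^+ 6)))^-1.
rewrite et scalerA mulrZZ mulVf ?scale1r; first by rewrite (defect_act o) // defect_eta_eta.
by rewrite oppr_eq0 !mulf_neq0 ?invr_eq0 ?mulf_neq0 ?expf_neq0.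
Qed.

End Relations.

(** * The calculus on the cone *)

(** Since omega^* omega = - q^6 omega omega^*, the volume form is omega omega^* times
    q^-6 (q^8 - q^6) / (q^2 - 1) = 1. *)
Lemma vol_omega : vol q = wedge (omega q) (omegas q).
Proof.
have [_ E _] := eta_theta_structure orientation_z.
rewrite /vol E -scalerDl scalerA -scalerDl mulr_algl scalerA -[RHS]scale1r; congr (_ *: _).
rewrite -[RHS]scale1r; congr (_ *: _).
have q21 : q%:C ^+ 2 - 1 != 0 by rewrite subr_eq0 qC_unity.
have -> : ((q ^- 6 / (q ^+ 2 - 1))%:C) = q%:C ^- 6 / (q%:C ^+ 2 - 1).
  by rewrite real_complexM !real_complexV real_complexB1 !real_complexX.
rewrite real_complexX; move: q%:C qC0 q21 => x x0 x2; field.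
by rewrite x0 x2.
Qed.

Lemma wedge_vol :
  [/\ exists k : R[i], wedge (omega q) (omega q) = (k *: dz q ^+ 4) *: vol q,
      wedge (omega q) (omegas q) = vol q,
      exists k : R[i], wedge (omegas q) (omega q) = (k%:A : disc q) *: vol q
    & exists k : R[i], wedge (omegas q) (omegas q) = (k *: dzs q ^+ 4) *: vol q].
Proof.
have [_ E [k Ek]] := eta_theta_structure orientation_z.
have [_ _ [k' Ek']] := eta_theta_structure orientation_zs.
rewrite vol_omega; split=> //; first by exists k.
  by exists (- q%:C ^+ 6).
exists (k' * - q%:C ^+ 6).
by rewrite Ek' E scalerA -scalerAr mulr1 scalerA mulrC.
Qed.

Lemma wedge_homog i j (x y : Omega1 q) : homog1 i x -> homog1 j y ->
  exists2 a, homog (i + j) a & wedge x y = a *: vol q.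
Proof.
move=> [a [b [ha hb ->]]] [a' [b' [ha' hb' ->]]].
have [[k1 E1] E2 [k3 E3] [k4 E4]] := wedge_vol.
move: (vol q) E1 E2 E3 E4 => v E1 E2 E3 E4.
have to := ract1_omega; have ts := ract1_omegas.
have sa := homog_sigma q0 _ _ ha'; have sb := homog_sigma q0 _ _ hb'.
rewrite !(wedgeDl (a *: _)) !(wedgeDr _ (a' *: _)) !wedge_scale //.
rewrite E1 E2 E3 E4 !scalerA -!scalerDl; eexists; last by reflexivity.
have h4 : homog 4 (dz q ^+ 4) := homog_exp 1 _ 4 (homog_z q).
have h4' : homog (-4) (dzs q ^+ 4) := homog_exp (-1) _ 4 (homog_zs q).
apply: homog_D; apply: homog_D.
- rewrite (_ : i + j = (i - 2) + (j - 2) + 4); last by ring.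
  by apply/homog_M/homogZ => //; apply: homog_M.
- rewrite (_ : i + j = (i - 2) + (j + 2)); last by ring.
  by apply: homog_M.
- rewrite (_ : i + j = (i + 2) + (j - 2) + 0); last by ring.
  by apply/homog_M/homog_C; apply: homog_M.
- rewrite (_ : i + j = (i + 2) + (j + 2) + (-4)); last by ring.
  by apply/homog_M/homogZ => //; apply: homog_M.
Qed.

Section Cone.
Variable N : nat.

Definition graded1 : set (Omega1 q) := sums [set x | exists2 n : int, (N %| n)%Z & homog1 n x].
Definition graded2 : set (Omega2 q) := sums [set w | exists2 n : int, (N %| n)%Z & homog2 n w].

Lemma cone1_graded x : cone1 q N x -> graded1 x.
Proof.
move: x; apply: (@sums_map _ _ _ _ id) => // _ [a0 [a1 [a2 [h0 h1 h2 ->]]]].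
move: a2 h2; apply: sums_map => [a b|a2 [n2 d2 h2]].
  by rewrite !ract1E sigmaD // !mulrDr.
move: a1 h1; apply: (@sums_map _ _ _ _ (fun a => ract1 (a0 *: diff a) a2)) => [a b|a1 [n1 d1 h1]].
  by rewrite diffD (scalerDr _ (diff a)) ract1D.
move: a0 h0; apply: (@sums_map _ _ _ _ (fun a => ract1 (a *: diff a1) a2)) => [a b|a0 [n0 d0 h0]].
  by rewrite scalerDl ract1D.
apply: sums_in; exists (n0 + n1 + n2); first by rewrite !rpredD.
by apply: homog1_ract => //; apply: homog1_lact => //; apply: homog1_diff.
Qed.

Lemma cone2_graded w : cone2 q N w -> graded2 w.
Proof.
move: w; apply: (@sums_map _ _ _ _ id) => // _ [a0 [a1 [a2 [a3 [[h0 h1 h2 h3] ->]]]]].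
rewrite ract2Z ract2_wedge -scale_wedge.
have g1 : graded1 (a0 *: diff a1) by apply/cone1_graded/cone1_lact/cone1_diff.
have g2 : graded1 (ract1 (diff a2) a3) by apply/cone1_graded/cone1_ract/cone1_diff.
move: (a0 *: diff a1) (ract1 (diff a2) a3) g1 g2 => x0 y0 hx0 hy0 {a0 a1 a2 a3 h0 h1 h2 h3}.
move: x0 hx0; apply: (@sums_map _ _ _ _ (fun x => wedge x _)) => [x y|x [i di hx]].
  by rewrite wedgeDl.
move: y0 hy0; apply: sums_map => [y t|y [j dj hy]]; first by rewrite wedgeDr.
apply: sums_in; exists (i + j); first by rewrite rpredD.
by apply: sums_in; exists i, j, x, y.
Qed.

Lemma homog2_vol n w : homog2 n w -> sums [set w | exists2 a, homog n a & w = a *: vol q] w.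
Proof.
move: w; apply: (@sums_map _ _ _ _ id) => // _ [i [j [x [y [<- hx hy ->]]]]].
by apply: sums_in; have [a ha ->] := wedge_homog _ _ _ _ hx hy; exists a.
Qed.

Lemma graded2_vol w : graded2 w -> exists2 a, cone q N a & w = a *: vol q.
Proof.
move: w; apply: sums_ind => [|w w' [n dn hw] [a' ha' ->]].
  by exists 0; [exact: sums0|rewrite scale0r].
suff [a ha ->] : exists2 a, cone q N a & w = a *: vol q.
  by exists (a + a'); [exact: sumsD|rewrite scalerDl].
move: w {hw} (homog2_vol _ _ hw); apply: sums_ind => [|_ _ [a ha ->] [b hb ->]].
  by exists 0; [exact: sums0|rewrite scale0r].
exists (a + b); last by rewrite scalerDl.
by apply: sumsD => //; apply: sums_in; exists n.
Qed.

(** The middle coefficient b in a0 da1 b db1 is moved out by da1 b = d(a1 b) - a1 db. *)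
Lemma cone2_wedge x y : cone1 q N x -> cone1 q N y -> cone2 q N (wedge x y).
Proof.
move=> hx hy; move: x hx; apply: (@sums_map _ _ _ _ (fun x => wedge x y)) => [x x'|].
  by rewrite wedgeDl.
move=> _ [a0 [a1 [a2 [h0 h1 h2 ->]]]].
move: y hy; apply: sums_map => [y y'|]; first by rewrite wedgeDr.
move=> _ [b0 [b1 [b2 [g0 g1 g2 ->]]]].
rewrite wedge_balanced -ract1Z scalerA -ract2_wedge.
set b := a2 * b0; have hb : cone q N b by apply: coneM.
rewrite -wedge_balanced ract1Z.
have -> : ract1 (diff a1) b = diff (a1 * b) - a1 *: diff b by rewrite diffM // addrK.
rewrite (scalerBr a0 (diff _)) scalerA (wedgeDl (a0 *: diff _)) wedgeNl ract2D -scaleN1r ract2Z.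
apply: sumsD; apply: sums_in.
  by exists a0, (a1 * b), b1, b2; rewrite -scale_wedge; split=> //; split=> //; apply: coneM.
exists (-1 * (a0 * a1)), b, b1, b2; rewrite -ract2Z scale_wedge scalerA; split=> //.
split=> //; rewrite mulN1r -scaleN1r; apply: coneZ; exact: coneM.
Qed.

Hypothesis hN : (1 < N)%N.

Lemma cone1_omega a : disc_mod q N (-2) a -> cone1 q N (a *: omega q).
Proof. by case: N hN => [|[|n]] // _; apply: (cone1_eta orientation_z). Qed.

Lemma cone1_omegas a : disc_mod q N 2 a -> cone1 q N (a *: omegas q).
Proof. by case: N hN => [|[|n]] // _; apply: (cone1_eta orientation_zs). Qed.

Lemma graded1_split x : graded1 x ->
  exists a b, [/\ disc_mod q N (-2) a, disc_mod q N 2 b & x = a *: omega q + b *: omegas q].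
Proof.
move: x; apply: sums_ind => [|x y [n dn [a [b [ha hb ->]]]] [a' [b' [ha' hb' ->]]]].
  by exists 0, 0; split; rewrite ?scale0r ?addr0 //; exact: sums0.
exists (a + a'), (b + b'); split; last by rewrite !scalerDl addrACA.
  apply: sumsD => //; apply: (disc_mod_homog _ _ _ _ _ ha).
  by rewrite -modzDml (dvdz_mod0P dn) add0r.
apply: sumsD => //; apply: (disc_mod_homog _ _ _ _ _ hb).
by rewrite -modzDml (dvdz_mod0P dn) add0r.
Qed.

Lemma cone1E x : cone1 q N x <-> graded1 x.
Proof.
split; first exact: cone1_graded.
by move=> /graded1_split [a [b [ha hb ->]]]; apply: sumsD; [exact: cone1_omega|exact: cone1_omegas].
Qed.

(** The element z^*^2 z^2 acts on the volume form as the identity. *)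
Lemma cone2_vol a : cone q N a -> cone2 q N (a *: vol q).
Proof.
move=> ha.
have [X0 E _] := eta_theta_structure orientation_zs.
have Xv : defect (dzs q) (dz q) *: vol q = 0.
  by rewrite vol_omega E scalerA -scalerAr mulr1 scaleAZ X0 scaler0.
have -> : a *: vol q = wedge ((q%:C ^- 4 *: (a * dzs q ^+ 2)) *: omega q) (dz q ^+ 2 *: omegas q).
  rewrite -[in LHS](defect_act orientation_zs _ _ 2 Xv) scalerA vol_omega.
  rewrite wedge_scale; last exact: ract1_omega.
  rewrite (expr2 (dz q)) sigmaM // sigma_z // real_complexX mulrZZ -exprD mulrZZ -(expr2 (dz q)).
  by rewrite mulVf ?expf_neq0 // scale1r mulrA.
apply: cone2_wedge.
  apply/cone1_omega; rewrite -mulr_algl -[-2]add0r; apply: disc_modM.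
    by rewrite -cone_disc_mod; apply: coneC.
  rewrite -[-2]add0r; apply: disc_modM; first by rewrite -cone_disc_mod.
  exact: (disc_mod_homog _ _ _ _ _ (homog_exp _ _ 2 (homog_zs q))).
apply: cone1_omegas.
exact: (disc_mod_homog _ _ _ _ _ (homog_exp _ _ 2 (homog_z q))).
Qed.

End Cone.
End OneForms.

Theorem mainTheorem3 (R : realType) (q : R) (N : nat)
    (hq : 0 < q < 1) (hN : (1 < N)%N) :
  [/\ cone1 q N = [set x + y | x in [set a *: omega q | a in disc_mod q N (-2)]
                             & y in [set b *: omegas q | b in disc_mod q N 2]],
      [set a *: omega q | a in disc_mod q N (-2)]
        `&` [set b *: omegas q | b in disc_mod q N 2] = [set 0],
      cone2 q N = [set a *: vol q | a in cone q N]
    & coneOmega q N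
        = sums [set w | exists2 n : int, (N %| n)%Z & homogOmega q n w]].
Proof.
have C1 := cone1E hq N hN.
have C2 w : cone2 q N w <-> graded2 N w.
  split; first exact: cone2_graded.
  by move=> /(graded2_vol hq) [a ha ->]; apply: cone2_vol.
split.
- apply/seteqP; split=> x.
    move=> /C1 /graded1_split [a [b [ha hb ->]]].
    by exists (a *: omega q); [exists a|exists (b *: omegas q) => //; exists b].
  by move=> [_ [a ha <-] [_ [b hb <-] <-]]; apply: sumsD; [apply: cone1_omega|apply: cone1_omegas].
- apply/seteqP; split=> x.
    move=> [[a _ <-] [b _]] /(congr1 fst) /=.
    rewrite scaler0 => E; have -> : a = 0 by rewrite -[LHS]mulr1; apply: esym E.
    by rewrite scale0r.
  by move=> ->; split; exists 0; rewrite ?scale0r //; exact: sums0.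
- apply/seteqP; split=> w.
    by move=> /C2 /(graded2_vol hq) [a ha ->]; exists a.
  by move=> [a ha <-]; apply: cone2_vol.
- apply/seteqP; split=> w.
    case: w => [[a x] w] [/= h0 /C1 h1 /C2 h2].
    have -> : (a, x, w) = ((a, 0, 0) : Omega q) + ((0, x, 0) : Omega q) + ((0, 0, w) : Omega q).
      by rewrite -[RHS]/(a + 0 + 0, 0 + x + 0, 0 + 0 + w) !addr0 !add0r.
    apply: (@sumsD (Omega q)); first apply: (@sumsD (Omega q)).
    + move: a {h1 h2} h0; rewrite cone0E.
      apply: (@sums_map _ (Omega q) _ _ (fun a => (a, 0, 0))) => [a b|a [n dn ha]].
        by rewrite -[RHS]/(a + b, 0 + 0, 0 + 0) !addr0.
      apply: sums_in; exists n => //; split=> //=; last exact: sums0.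
      by exists 0, 0; split; rewrite ?scale0r ?addr0 //; apply: homog_0.
    + move: x {h0 h2} h1.
      apply: (@sums_map _ (Omega q) _ _ (fun x => (0, x, 0))) => [x y|x [n dn hx]].
        by rewrite -[RHS]/(0 + 0, x + y, 0 + 0) !addr0.
      by apply: sums_in; exists n => //; split=> //=; [exact: homog_0|exact: sums0].
    + move: w {h0 h1} h2.
      apply: (@sums_map _ (Omega q) _ _ (fun w => (0, 0, w))) => [w w'|w [n dn hw]].
        by rewrite -[RHS]/(0 + 0, 0 + 0, w + w') !addr0.
      apply: sums_in; exists n => //; split=> //=; first exact: homog_0.
      by exists 0, 0; split; rewrite ?scale0r ?addr0 //; apply: homog_0.
  move: w; apply: sums_ind => [|w w' [n dn [h0 h1 h2]] [h0' h1' h2']].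
    by split; exact: sums0.
  have k0 : cone0 q N w.1.1 by rewrite cone0E; apply: sums_in; exists n.
  have k1 : cone1 q N w.1.2 by apply/C1; apply: sums_in; exists n.
  have k2 : cone2 q N w.2 by apply/C2; apply: sums_in; exists n.
  by split; apply: sumsD.
Qed.
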